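(* Let $\boldsymbol{A}\in\mathcal{DM}_{\rm loc}(\Omega)$, let $\lambda:\Omega\to[0,1]$ be a Borel function and let $u\in BV^{\boldsymbol{A},\lambda}(\Omega)$. Let $E\subset\Omega$ be a Borel set. If $\chi_E\in BV^{u^\lambda\boldsymbol{A},0}(\Omega)$ and $\operatorname{supp}(\chi_E^-u^\lambda|\boldsymbol{A}|)\Subset\Omega$, then $$\int_{E^1}u^\lambda\,d\,\mathrm{div}\boldsymbol{A}+\int_{E^1}d(\boldsymbol{A},Du)_\lambda=-\int_{\partial^-E}d(u^\lambda\boldsymbol{A},D\chi_E)_0;$$ while, if $\chi_E\in BV^{u^\lambda\boldsymbol{A},1}(\Omega)$ and $\operatorname{supp}(\chi_E^+u^\lambda|\boldsymbol{A}|)\Subset\Omega$, then $$\int_{E^1\cup\partial^*E}u^\lambda\,d\,\mathrm{div}\boldsymbol{A}+\int_{E^1\cup\partial^*E}d(\boldsymbol{A},Du)_\lambda=-\int_{\partial^-E}d(u^\lambda\boldsymbol{A},D\chi_E)_1.$$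
   Context: $\Omega\subset\mathbb{R}^N$ is a nonempty open set; $\mathscr{L}^N$ is Lebesgue measure. $\mathcal{M}(\Omega)$, $\mathcal{M}_{\rm loc}(\Omega)$ are the finite, respectively locally finite, (signed) Radon measures on $\Omega$, and $\mathcal{M}(\Omega;\mathbb{R}^N)$, $\mathcal{M}_{\rm loc}(\Omega;\mathbb{R}^N)$ their vector-valued versions; $|\mu|$ is the total variation of $\mu$. $F\Subset\Omega$ means that $\overline F$ is bounded and $\overline F\subset\Omega$. $\mathscr{B}(\Omega)$ is the set of Borel functions $u:\Omega\to\mathbb{R}$ modulo $\mathscr{L}^N$-a.e. equality. Density: $D(E;x):=\lim_{r\to0^+}\mathscr{L}^N(E\cap B_r(x))/\mathscr{L}^N(B_r(x))$ when it exists. $E^1:=\{x:D(E;x)=1\}$, $\partial^*E:=\mathbb{R}^N\setminus(E^1\cup(\mathbb{R}^N\setminus E)^1)$, and $\partial^-E:=\{x\in\mathbb{R}^N:0<\mathscr{L}^N(E\cap B_r(x))<\mathscr{L}^N(B_r(x))\ \forall r>0\}$. Integrals over $\partial^-E$ (or $E^1$, $\partial^*E$) of measures on $\Omega$ are over the intersection with $\Omega$. For $u\in\mathscr{B}(\Omega)$, for every $x\in\Omega$, $$u^-(x):=\sup\{t\in\overline{\mathbb{R}}:D(\{u<t\};x)=0\},\quad u^+(x):=\inf\{t\in\overline{\mathbb{R}}:D(\{u>t\};x)=0\},$$ and $Z_u:=\{u^+=+\infty,\ u^-=-\infty\}$. For a Borel $\lambda:\Omega\to[0,1]$ set $u^\lambda:=(1-\lambda)u^-+\lambda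 u^+$ on $\Omega\setminus Z_u$ (with $0\cdot(\pm\infty)=0$), and on $Z_u$: $u^\lambda:=+\infty,\,0,\,-\infty$ according to $\lambda>\frac12$, $\lambda=\frac12$, $\lambda<\frac12$. In particular $u^0=u^-$, $u^1=u^+$, $\chi_E^-=\chi_{E^1}$, $\chi_E^+=\chi_{E^1\cup\partial^*E}$. $\mathcal{DM}_{\rm loc}(\Omega)$ is the set of $\boldsymbol{A}\in\mathcal{M}_{\rm loc}(\Omega;\mathbb{R}^N)$ with distributional divergence $\mathrm{div}\boldsymbol{A}\in\mathcal{M}_{\rm loc}(\Omega)$, i.e. $\int_\Omega\varphi\,d\,\mathrm{div}\boldsymbol{A}=-\int_\Omega\nabla\varphi\cdot d\boldsymbol{A}$ for all $\varphi\in C_c^\infty(\Omega)$. $X^{\boldsymbol{A},\lambda}(\Omega):=\{u\in\mathscr{B}(\Omega):u^\lambda\in L^1(\Omega,|\boldsymbol{A}|)\cap L^1(\Omega,|\mathrm{div}\boldsymbol{A}|)\}$; $X^{\boldsymbol{A},\lambda}_{\rm loc}(\Omega)$ is the analogue with $L^1_{\rm loc}$. For $u\in X^{\boldsymbol{A},\lambda}_{\rm loc}(\Omega)$ the $\lambda$-pairing is the distribution $$\langle(\boldsymbol{A},Du)_\lambda,\varphi\rangle:=-\int_\Omega u^\lambda\varphi\,d\,\mathrm{div}\boldsymbol{A}-\int_\Omega u^\lambda\nabla\varphi\cdot d\boldsymbol{A},\qquad\varphi\in C_c^\infty(\Omega).$$ $BV^{\boldsymbol{A},\lambda}(\Omega):=\{u\in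 X^{\boldsymbol{A},\lambda}(\Omega):(\boldsymbol{A},Du)_\lambda\in\mathcal{M}(\Omega)\}$. If $u\in BV^{\boldsymbol{A},\lambda}(\Omega)$, then $u^\lambda\boldsymbol{A}\in\mathcal{DM}_{\rm loc}(\Omega)$. For such $u$ and for $t\in\{0,1\}$, $X^{u^\lambda\boldsymbol{A},t}(\Omega):=\{v\in\mathscr{B}(\Omega):v^t\in L^1(\Omega,|u^\lambda\boldsymbol{A}|)\cap L^1(\Omega,|\mathrm{div}(u^\lambda\boldsymbol{A})|)\}$, where $v^0=v^-$ and $v^1=v^+$; for $v\in X^{u^\lambda\boldsymbol{A},t}(\Omega)$ the pairing $(u^\lambda\boldsymbol{A},Dv)_t$ is the distribution $$\langle(u^\lambda\boldsymbol{A},Dv)_t,\varphi\rangle:=-\int_\Omega v^t\varphi\,d\,\mathrm{div}(u^\lambda\boldsymbol{A})-\int_\Omega v^tu^\lambda\nabla\varphi\cdot d\boldsymbol{A},\qquad\varphi\in C_c^\infty(\Omega);$$ and $BV^{u^\lambda\boldsymbol{A},t}(\Omega):=\{v\in X^{u^\lambda\boldsymbol{A},t}(\Omega):(u^\lambda\boldsymbol{A},Dv)_t\in\mathcal{M}(\Omega)\}$. $\operatorname{supp}$ denotes the (closed) support of a measure. *)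

(* Defs.v *)
From HB Require Import structures.
From mathcomp Require Import all_boot all_order all_algebra.
From mathcomp Require Import all_classical all_reals all_analysis.

Set Implicit Arguments.
Unset Strict Implicit.
Unset Printing Implicit Defensive.

Import Order.TTheory GRing.Theory Num.Theory.
Import numFieldNormedType.Exports.

Local Open Scope classical_set_scope.
Local Open Scope ring_scope.

Notation Rn R n := (g_sigma_algebraType (@open 'rV[R]_n)).

(* The norm of the library on 'rV[R]_n is the sup norm; balls and total
   variations below use the Euclidean one. *)
Definition enorm (R : realType) (n : nat) (x : 'rV[R]_n) : R :=
  Num.sqrt (\sum_(i < n) x 0 i ^+ 2).

Definition eball (R : realType) (n : nat) (x : 'rV[R]_n) (r : R)
    : set 'rV[R]_n :=
  [set y | enorm (y - x) < r].

(* n-dimensional Lebesgue measure on Borel sets, as the iterated product of the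
   one-dimensional one: the measure of a set is the integral of the measures of
   its sections with respect to the first coordinate. *)
Fixpoint lebesgueN (R : realType) (n : nat) : set 'rV[R]_n -> \bar R :=
  if n is m.+1 then
    fun B => (\int[@lebesgue_measure R]_(t in [set: R])
      @lebesgueN R m
        [set y | B (row_mx (\row_(_ < 1) t) y : 'rV[R]_(m.+1))])%E
  else fun B => @dirac _ (Rn R 0) (0 : 'rV[R]_0) R B.

Definition relcompact (R : realType) (n : nat) (F Omega : set 'rV[R]_n) :=
  bounded_set (closure F) /\ closure F `<=` Omega.

Section density.
Context {R : realType} {N : nat}.
Implicit Types (E : set 'rV[R]_N) (x : 'rV[R]_N).

Definition has_density E x (d : R) : Prop :=
  fine (lebesgueN (E `&` eball x r)) / fine (lebesgueN (eball x r))
    @[r --> 0^'+] --> d.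

Definition density1 E : set 'rV[R]_N := [set x | has_density E x 1].

Definition ess_boundary E : set 'rV[R]_N :=
  ~` (density1 E `|` density1 (~` E)).

Definition minus_boundary E : set 'rV[R]_N :=
  [set x | forall r : R, 0 < r ->
    (0 < lebesgueN (E `&` eball x r))%E /\
    (lebesgueN (E `&` eball x r) < lebesgueN (eball x r))%E].

End density.

(* Functions on Omega are given on the whole space, only their values on Omega
   are used. *)
Section precise_representatives.
Context {R : realType} {N : nat}.
Implicit Types (Omega : set 'rV[R]_N) (u lam : 'rV[R]_N -> R) (x : 'rV[R]_N).
Local Open Scope ereal_scope.

Definition lower_rep Omega u x : \bar R :=
  ereal_sup [set t : \bar R |
    has_density [set y | Omega y /\ (u y)%:E < t] x 0].

Definition upper_rep Omega u x : \bar R :=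
  ereal_inf [set t : \bar R |
    has_density [set y | Omega y /\ t < (u y)%:E] x 0].

Definition lam_rep Omega lam u x : \bar R :=
  if (upper_rep Omega u x == +oo) && (lower_rep Omega u x == -oo) then
    if (2^-1 < lam x)%R then +oo else if (lam x == 2^-1)%R then 0 else -oo
  else
    (1 - lam x)%:E * lower_rep Omega u x + (lam x)%:E * upper_rep Omega u x.

End precise_representatives.

Section test_functions.
Context {R : realType} {N : nat}.

Definition pderiv (i : 'I_N) (f : 'rV[R]_N -> R) : 'rV[R]_N -> R :=
  fun x => 'D_(delta_mx 0 i) f x.

Definition iter_pderiv (s : seq 'I_N) (f : 'rV[R]_N -> R) : 'rV[R]_N -> R :=
  foldr pderiv f s.

Definition smooth (f : 'rV[R]_N -> R) : Prop :=
  forall s : seq 'I_N, continuous (iter_pderiv s f) /\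
    forall i x, derivable (iter_pderiv s f) x (delta_mx 0 i).

Definition test_function (Omega : set 'rV[R]_N) (phi : 'rV[R]_N -> R) : Prop :=
  smooth phi /\ relcompact [set x | phi x != 0] Omega.

End test_functions.

(* Real measures on Omega are represented by set functions on the Borel sets of
   R^N.  Only their values on the Borel subsets of Omega (finite case), or on
   the Borel sets that are relatively compact in Omega (locally finite case, as
   the others need not have a well-defined measure), are meaningful.
   Vector measures are families of components. *)
Section radon_measures.
Context {R : realType} {N : nat}.
Local Open Scope ereal_scope.
Implicit Types (Omega K B D : set (Rn R N)) (mu : set (Rn R N) -> \bar R).

Definition charge_on K mu : Prop :=
  exists nu : {charge set (Rn R N) -> \bar R},
    forall B, measurable B -> B `<=` K -> mu B = nu B.

Definition radon_fin Omega mu : Prop := charge_on Omega mu.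

Definition radon_loc Omega mu : Prop :=
  forall K, measurable K -> relcompact K Omega -> charge_on K mu.

Definition vector_variation (k : nat) Omega
    (A : 'I_k -> set (Rn R N) -> \bar R) : set (Rn R N) -> \bar R :=
  fun B => ereal_sup
    [set \sum_(n <oo) (enorm (\row_i fine (A i (F n))))%:E | F in
      [set F : (set (Rn R N))^nat |
        [/\ forall n, measurable (F n) /\ relcompact (F n) Omega,
            trivIset setT F & \bigcup_n F n = B `&` Omega]]].

Definition signed_variation Omega mu :=
  vector_variation Omega (fun _ : 'I_1 => mu).

Definition upper_variation Omega mu : set (Rn R N) -> \bar R :=
  fun B => ereal_sup
    [set mu F | F in
      [set F : set (Rn R N) | [/\ measurable F, relcompact F Omega & F `<=` B]]].

Definition lower_variation Omega mu : set (Rn R N) -> \bar R :=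
  upper_variation Omega (fun B => - mu B).

(* The Jordan decomposition of mu is given by its upper and lower variations;
   they are measures with values in [0, +oo] even when mu is only locally
   finite. *)
Definition signed_integral Omega mu D (f : Rn R N -> \bar R) : \bar R :=
  \int[upper_variation Omega mu]_(x in D) f x -
  \int[lower_variation Omega mu]_(x in D) f x.

(* the measure f mu *)
Definition density_measure Omega (f : Rn R N -> \bar R) mu
    : set (Rn R N) -> \bar R :=
  fun B => signed_integral Omega mu (B `&` Omega) f.

Definition measure_support Omega mu : set (Rn R N) :=
  [set x | Omega x /\ forall U : set 'rV[R]_N, open U -> U x ->
    U `<=` Omega -> 0 < signed_variation Omega mu U].

End radon_measures.

Section pairings.
Context {R : realType} {N : nat}.
Local Open Scope ereal_scope.
Implicit Types (Omega : set (Rn R N)) (A : 'I_N -> set (Rn R N) -> \bar R).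
Implicit Types (u v lam phi : Rn R N -> R) (w : Rn R N -> \bar R).
Implicit Types (mu : set (Rn R N) -> \bar R).

Definition is_divergence Omega A mu : Prop :=
  radon_loc Omega mu /\
  forall phi, test_function Omega phi ->
    signed_integral Omega mu Omega (EFin \o phi) =
    - \sum_(i < N) signed_integral Omega (A i) Omega (EFin \o pderiv i phi).

Definition DM_loc Omega A : Prop :=
  (forall i, radon_loc Omega (A i)) /\ exists mu, is_divergence Omega A mu.

(* Measures satisfying is_divergence agree on the Borel sets relatively compact
   in Omega, hence have the same integrals and variation. *)
Definition divergence Omega A : set (Rn R N) -> \bar R :=
  xget (fun=> 0) [set mu | is_divergence Omega A mu].

Definition X_space Omega A lam u : Prop :=
  [/\ measurable_fun Omega u,
      (vector_variation Omega A).-integrable Omega (lam_rep Omega lam u) &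
      (signed_variation Omega (divergence Omega A)).-integrable Omega
        (lam_rep Omega lam u)].

Definition represented_by Omega (T : (Rn R N -> R) -> \bar R) mu : Prop :=
  radon_fin Omega mu /\
  forall phi, test_function Omega phi ->
    T phi = signed_integral Omega mu Omega (EFin \o phi).

(* Measures representing T agree on the Borel subsets of Omega. *)
Definition measure_of_distribution Omega (T : (Rn R N -> R) -> \bar R) :=
  xget (fun=> 0) [set mu | represented_by Omega T mu].

Definition pairing Omega A lam u : (Rn R N -> R) -> \bar R :=
  fun phi =>
    - signed_integral Omega (divergence Omega A) Omega
        (fun x => lam_rep Omega lam u x * (phi x)%:E)
    - \sum_(i < N) signed_integral Omega (A i) Omega
        (fun x => lam_rep Omega lam u x * (pderiv i phi x)%:E).

Definition pairing_measure Omega A lam u :=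
  measure_of_distribution Omega (pairing Omega A lam u).

Definition BV_space Omega A lam u : Prop :=
  X_space Omega A lam u /\
  exists mu, represented_by Omega (pairing Omega A lam u) mu.

Definition weighted_field Omega w A : 'I_N -> set (Rn R N) -> \bar R :=
  fun i => density_measure Omega w (A i).

(* The pairing of v with the field w A, for the representative v^t; it is used
   for t = 0, 1 and w = u^lambda. *)
Definition weighted_pairing Omega w A (t : R) v : (Rn R N -> R) -> \bar R :=
  fun phi =>
    - signed_integral Omega (divergence Omega (weighted_field Omega w A)) Omega
        (fun x => lam_rep Omega (fun=> t) v x * (phi x)%:E)
    - \sum_(i < N) signed_integral Omega (A i) Omega
        (fun x => lam_rep Omega (fun=> t) v x * w x * (pderiv i phi x)%:E).

Definition weighted_pairing_measure Omega w A (t : R) v :=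
  measure_of_distribution Omega (weighted_pairing Omega w A t v).

Definition weighted_BV_space Omega w A (t : R) v : Prop :=
  X_space Omega (weighted_field Omega w A) (fun=> t) v /\
  exists mu, represented_by Omega (weighted_pairing Omega w A t v) mu.

End pairings.

(* Main.v *)
From HB Require Import structures.
Require Import Defs.
From mathcomp Require Import all_boot all_order all_algebra.
From mathcomp Require Import all_classical all_reals all_analysis.
From mathcomp Require Import measurable_realfun ring lra.

(* Write w = u^lambda and B = w A.  Testing with smooth functions shows that the
   measure m = w div A + (A, Du)_lambda is the divergence of B, so the left-hand
   side is m(G), where chi_E^- (resp. chi_E^+) is the indicator of G.  The pairing
   Q = (B, D chi_E)_t satisfies Q = div (1_G B) - 1_G m.

   - Near a point outside the boundary, E or its complement is Lebesgue-null, so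
     1_G is locally constant equal to 0 or 1 and Q vanishes on test functions
     supported there; a charge is determined by its integrals of test functions,
     hence Q is concentrated on the boundary.
   - Test Q with cutoffs that increase to 1 on Omega.  Since 1_G B has compact
     support, their gradients eventually vanish on that support, and the limit
     is Q(Omega) = - m(G). *)

Set Implicit Arguments.
Unset Strict Implicit.
Unset Printing Implicit Defensive.

Import Order.TTheory GRing.Theory Num.Theory.
Import numFieldNormedType.Exports.

Local Open Scope classical_set_scope.
Local Open Scope ring_scope.

(** * Smooth cutoff functions *)

(** The variations, the integrals against them and [lebesgueN] are built from bare set functions, so
    each is first matched on Borel sets with a genuine measure. A and div A may have infinite mass
    on Omega, hence their positive and negative parts can be subtracted only on relatively compact
    sets; once multiplied by the integrable w they become finite. Signed measures are handled as
    differences of two measures, and identities between them are proved as equalities of sums of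
    measures. Two further points shape the argument. The support hypothesis concerns 1_G w |A|,
    while the gradient terms are integrals against the components of A: a countable cover of the
    complement of the support by rational balls shows that 1_G w vanishes there almost everywhere
    for both variations of each component. The Borel measurability of G in Omega is read off from
    the assumption that chi_E lies in the space X, where its representative is measurable. *)

Section flat_function.
Context {R : realType}.
Implicit Types (p : {poly R}) (t : R).

(** The polynomial parameter makes this family of flat functions stable under differentiation, so
    that a single derivative computation covers all orders. *)
Definition flat p t : R := if t <= 0 then 0 else p.[t^-1] * expR (- t^-1).

(** Applied to [p * 'X], this bound makes the difference quotient of [flat p] at 0 tend to 0. *)
Lemma flat_bound p : exists C : R, forall t, `|flat p t| <= C * `|t|.
Proof.
(* Here [s] is [t^-1]. The free power [s ^+ k] lets the induction on [p] go through: it absorbs the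
   factor ['X] of [p * 'X + c]. *)
suff H : forall k, exists C : R, 0 <= C /\ forall s, 0 < s ->
    `|p.[s]| * s ^+ k * expR (- s) * s <= C.
  have [C [C0 HC]] := H 0%N; exists C => t; rewrite /flat; case: ifPn => t0.
    by rewrite normr0 mulr_ge0.
  have {}t0 : 0 < t by rewrite ltNge.
  rewrite (gtr0_norm t0) normrM (ger0_norm (expR_ge0 _)) -ler_pdivrMr//.
  by have := HC _ (divr_gt0 ltr01 t0); rewrite mul1r expr0 mulr1.
elim/poly_ind: p => [|p c IH] k.
  by exists 0; split=> // s s0; rewrite horner0 normr0 !mul0r.
have [C [C0 HC]] := IH k.+1.
exists (C + `|c| * k.+1`!%:R); split; first by rewrite addr_ge0 ?mulr_ge0.
move=> s s0; rewrite hornerMXaddC.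
have es : s ^+ k.+1 * expR (- s) <= k.+1`!%:R.
  rewrite expRN ler_pdivrMr ?expR_gt0// -ler_pdivrMl ?ltr0n ?fact_gt0//.
  by apply: le_trans (expR_ge1Dxn k (ltW s0)); rewrite mulrC lerDr.
apply: (@le_trans _ _ ((`|p.[s]| * s ^+ k.+1 * expR (- s) * s) +
   `|c| * (s ^+ k.+1 * expR (- s)))); last first.
  by rewrite lerD ?HC// ler_wpM2l.
rewrite [leRHS](_ : _ = (`|p.[s]| * s + `|c|) * (s ^+ k * expR (- s) * s)); last first.
  by rewrite exprSr; ring.
rewrite -!mulrA; apply: ler_wpM2r.
  by rewrite !mulr_ge0// ?exprn_ge0 ?expR_ge0// ltW.
by rewrite (le_trans (ler_normD _ _))// normrM (gtr0_norm s0).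
Qed.

Lemma is_derive_flat p t : is_derive t (1 : R) (flat p) (flat ('X^2 * (p - p^`())) t).
Proof.
have [t0|t0|->] := ltgtP t 0.
- have -> : flat ('X^2 * (p - p^`())) t = 0 by rewrite /flat ltW.
  apply: (@near_eq_is_derive _ _ _ (cst 0)).
  near=> z; rewrite /flat ifT//; apply/ltW; near: z; exact: lt_nbhsl.
- apply: (@near_eq_is_derive _ _ _ (fun t => p.[t^-1] * expR (- t^-1))).
  + near=> z; rewrite /flat ifF//; apply/negbTE; rewrite -ltNge.
    near: z; exact: lt_nbhsr.
  have tn0 : t != 0 by rewrite gt_eqF.
  have dV : is_derive t (1 : R) (fun y : R => y^-1) (- t ^- 2 *: 1).
    exact: (@is_deriveV _ id).
  have d1 : is_derive t (1 : R) (fun y => p.[y^-1]) (p^`().[t^-1] * (- t ^- 2 *: 1)).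
    exact: (@is_derive1_comp _ (horner p) (fun y => y^-1)).
  have dN : is_derive t (1 : R) (fun y : R => - y^-1) (- (- t ^- 2 *: 1)).
    exact: is_deriveN.
  have d2 : is_derive t (1 : R) (fun y => expR (- y^-1)) (expR (- t^-1) * - (- t ^- 2 *: 1)).
    exact: (@is_derive1_comp _ expR (fun y => - y^-1)).
  apply: is_derive_eq.
  rewrite /flat ifF; last by apply/negbTE; rewrite -ltNge.
  rewrite !hornerE /GRing.scale/= !mulr1 -exprVn.
  ring.
(* At 0 the slope function is [flat (p * 'X)], since dividing by [z] multiplies the polynomial by
   ['X]; [flat_bound] makes it continuous at 0. *)
- apply/is_derive1_caratheodory; exists (flat (p * 'X)); split.
  + move=> z; rewrite subr0 {2}/flat lexx subr0 /flat; case: ifPn => z0.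
      by rewrite mul0r.
    rewrite hornerMX; field; rewrite gt_eqF// ltNge//.
  + have [C HC] := flat_bound (p * 'X).
    apply/cvgrPdist_le => e e0.
    have C1 : 0 < `|C| + 1 by rewrite ltr_wpDl.
    near=> z.
    rewrite /flat lexx sub0r normrN -/(flat _ _).
    apply: (le_trans (HC z)); apply: (@le_trans _ _ ((`|C| + 1) * `|z|)).
      by rewrite ler_wpM2r// (le_trans (ler_norm _))// lerDl.
    rewrite -ler_pdivlMl// -[z]subr0 distrC; near: z.
    by apply: cvgr_dist_le; [exact: cvg_id|rewrite mulr_gt0 ?invr_gt0].
  + by rewrite /flat lexx.
Unshelve. all: by end_near. Qed.

End flat_function.

Section elementary_functions.
Context {R : realType} {N : nat}.

(** [smooth] quantifies over all iterated partial derivatives. A syntactic class of continuous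
    functions that is closed under partial differentiation reduces this to one derivative at a
    time. *)
Inductive elementary : ('rV[R]_N -> R) -> Prop :=
| elementary_cst c : elementary (fun=> c)
| elementary_flat p a b i : elementary (fun x => flat p (a * x 0 i + b))
| elementary_add f g :
    elementary f -> elementary g -> elementary (fun x => f x + g x)
| elementary_mul f g :
    elementary f -> elementary g -> elementary (fun x => f x * g x)
| elementary_inv f : elementary f -> (forall x, f x != 0) ->
    elementary (fun x => (f x)^-1).

Lemma is_derive_coord (h : R -> R) (i j : 'I_N) (x : 'rV[R]_N) (d : R) :
  is_derive (x 0 i) (1 : R) h d ->
  is_derive x (delta_mx 0 j) (fun y : 'rV[R]_N => h (y 0 i)) ((i == j)%:R * d).
Proof.
case: (eqVneq i j) => [<-|ij] [dh <-]; last first.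
  have E : (fun k : R => k^-1 *: (((fun y : 'rV[R]_N => h (y 0 i)) \o shift x)
      (k *: delta_mx 0 j) - h (x 0 i))) = fun=> 0.
    by apply/funext => k /=; rewrite !mxE (negbTE ij) andbF mulr0 add0r
      subrr scaler0.
  split; rewrite /derivable /derive E.
    exact: is_cvg_cst.
  by rewrite mul0r lim_cst.
have E : (fun k : R => k^-1 *: (((fun y : 'rV[R]_N => h (y 0 i)) \o shift x)
      (k *: delta_mx 0 i) - h (x 0 i))) =
    (fun k : R => k^-1 *: ((h \o shift (x 0 i)) (k *: 1) - h (x 0 i))).
  by apply/funext => k /=; rewrite !mxE !eqxx.
by rewrite mul1r; split; [rewrite /derivable E; exact: dh|rewrite /derive E].
Qed.

Lemma elementary_is_derive f : elementary f -> forall j, exists2 f', elementary f' &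
  forall x, is_derive x (delta_mx 0 j) f (f' x).
Proof.
elim=> {f} [c|p a b i|f g _ IHf _ IHg|f g ef IHf eg IHg|f ef IHf f0] j.
- by exists (fun=> 0); [exact: elementary_cst|move=> x; exact: is_derive_cst].
- exists (fun x => (i == j)%:R * (flat ('X^2 * (p - p^`())) (a * x 0 i + b) * a)).
    apply: elementary_mul; first exact: elementary_cst.
    by apply: elementary_mul; [exact: elementary_flat|exact: elementary_cst].
  move=> x; apply: (@is_derive_coord (fun t => flat p (a * t + b))).
  apply: (@is_derive1_comp _ (flat p) (fun t => a * t + b)).
    exact: is_derive_flat.
  have := is_deriveD (is_deriveZ a (is_derive_id (x 0 i) (1 : R)))
    (is_derive_cst b (x 0 i) (1 : R)).
  by rewrite addr0 [_%:A]mulr1.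
- have [f' ef' df] := IHf j; have [g' eg' dg] := IHg j.
  exists (fun x => f' x + g' x); first exact: elementary_add.
  by move=> x; exact: is_deriveD.
- have [f' ef' df] := IHf j; have [g' eg' dg] := IHg j.
  exists (fun x => f x * g' x + g x * f' x).
    by apply: elementary_add; exact: elementary_mul.
  by move=> x; exact: is_deriveM.
- have [f' ef' df] := IHf j.
  exists (fun x => -1 * ((f x)^-1 * (f x)^-1 * f' x)).
    apply: elementary_mul; first exact: elementary_cst.
    apply: elementary_mul => //.
    by apply: elementary_mul; exact: elementary_inv.
  move=> x; have [dfx <-] := df x.
  split; first exact: derivableV.
  by rewrite deriveV// /GRing.scale/= expr2 invfM mulN1r mulNr.
Qed.

Lemma elementary_continuous f : elementary f -> continuous f.
Proof.
elim=> {f} [c|p a b i|f g _ IHf _ IHg|f g ef IHf eg IHg|f ef IHf f0] x.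
- exact: cst_continuous.
- apply: (@continuous_comp _ _ _ (fun y : 'rV[R]_N => a * y 0 i + b) (flat p)).
    apply: continuousD; last exact: cst_continuous.
    by apply: continuousM; [exact: cst_continuous|exact: coord_continuous].
  apply/differentiable_continuous/derivable1_diffP.
  by case: (is_derive_flat p (a * x 0 i + b)).
- by apply: continuousD; [exact: IHf|exact: IHg].
- by apply: continuousM; [exact: IHf|exact: IHg].
- by apply: continuousV; [exact: f0|exact: IHf].
Qed.

Lemma elementary_smooth f : elementary f -> smooth f.
Proof.
move=> ef s; suff : elementary (iter_pderiv s f).
  move=> es; split; first exact: elementary_continuous.
  by move=> i x; have [f' _ /(_ x)[]] := elementary_is_derive es i.
elim: s => //= i s es; have [f' ef' df] := elementary_is_derive es i.
suff -> : pderiv i (iter_pderiv s f) = f' by [].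
by apply/funext => x; rewrite /pderiv; have [_ ->] := df x.
Qed.

End elementary_functions.

Section relcompact_lemmas.
Context {R : realType} {N : nat}.
Implicit Types (F G V : set 'rV[R]_N) (c x : 'rV[R]_N) (r s : R).

Lemma relcompact_sub F G V : F `<=` G -> relcompact G V -> relcompact F V.
Proof.
move=> FG [bG cG]; split; last exact: (subset_trans (closure_subset FG)).
have [M [Mr HM]] := bG; exists M; split=> // K MK x Fx; apply: HM MK _ _.
exact: closure_subset FG x Fx.
Qed.

Lemma relcompactU F G V :
  relcompact F V -> relcompact G V -> relcompact (F `|` G) V.
Proof.
move=> [bF cF] [bG cG]; rewrite /relcompact closureU; split; last first.
  by rewrite subUset.
have [M [Mr HM]] := bF; have [L [Lr HL]] := bG.
exists (Num.max M L); split; first by rewrite num_real.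
move=> K; rewrite gt_max => /andP[MK LK] x [Fx|Gx]; [exact: HM MK _ _|exact: HL LK _ _].
Qed.

Lemma relcompact0 V : relcompact set0 V.
Proof.
rewrite /relcompact closure0; split; last exact: sub0set.
by exists 0; split=> // M _ x [].
Qed.

Lemma mx_ballP c r x : 0 < r -> ball c r x <-> forall i, `|c 0 i - x 0 i| < r.
Proof.
move=> r0; split=> [[_ H] i|H]; first exact: (H 0 i).
split=> // i j.
by rewrite (ord1 i); exact: H.
Qed.

Lemma relcompact_ball c r s V : r < s -> ball c s `<=` V -> relcompact (ball c r) V.
Proof.
move=> rs cV; have cb : closure (ball c r) `<=` ball c s.
  move=> x /(_ (ball x (s - r))) []; first by apply: nbhsx_ballx; rewrite subr_gt0.
  move=> y [cy xy]; have := ball_triangle cy (ball_sym xy).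
  by rewrite addrC subrK.
split; last exact: subset_trans cV.
exists (`|c| + s); split; first by rewrite num_real.
move=> M cM x /cb; rewrite -ball_normE/= => cx.
rewrite ltW// (le_lt_trans _ cM)// -(subKr c x) (le_trans (ler_normB _ _))//.
by rewrite lerD2l ltW.
Qed.

Lemma relcompact_compact F V : relcompact F V -> compact (closure F).
Proof.
by move=> [bF _]; apply: bounded_closed_compact => //; exact: closed_closure.
Qed.

End relcompact_lemmas.

Section cutoff.
Context {R : realType} {N : nat}.
Implicit Types (V : set 'rV[R]_N) (c x : 'rV[R]_N) (r : R).

(** The usual smooth transition from 0 (for [t <= 0]) to 1 (for [1 <= t]); the denominator never
    vanishes because [t] or [1 - t] is positive. *)
Definition step (t : R) : R := flat 1 t * (flat 1 t + flat 1 (1 - t))^-1.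

Lemma flat1_ge0 (t : R) : 0 <= flat 1 t.
Proof. by rewrite /flat; case: ifPn => // _; rewrite hornerC mul1r expR_ge0. Qed.

Lemma flat1_gt0 (t : R) : 0 < t -> 0 < flat 1 t.
Proof. by move=> t0; rewrite /flat leNgt t0/= hornerC mul1r expR_gt0. Qed.

Lemma flat1_eq0 (t : R) : t <= 0 -> flat 1 t = 0.
Proof. by rewrite /flat => ->. Qed.

Lemma step_den_gt0 (t : R) : 0 < flat 1 t + flat 1 (1 - t).
Proof.
have [t0|t0] := ltP 0 t.
  by rewrite ltr_pwDl ?flat1_ge0 ?flat1_gt0.
by rewrite ltr_wpDl ?flat1_ge0 ?flat1_gt0//; lra.
Qed.

Lemma step_ge0 t : 0 <= step t.
Proof. by rewrite mulr_ge0 ?flat1_ge0// invr_ge0 ltW ?step_den_gt0. Qed.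

Lemma step_le1 t : step t <= 1.
Proof. by rewrite ler_pdivrMr ?step_den_gt0// mul1r lerDl flat1_ge0. Qed.

Lemma step_eq1 t : 1 <= t -> step t = 1.
Proof.
move=> t1; rewrite /step (@flat1_eq0 (1 - t)) ?subr_le0// addr0 divff//.
by rewrite gt_eqF// flat1_gt0// (lt_le_trans ltr01).
Qed.

Lemma step_eq0 t : t <= 0 -> step t = 0.
Proof. by move=> t0; rewrite /step flat1_eq0// mul0r. Qed.

Lemma elementary_step (a b : R) (i : 'I_N) :
  elementary (fun x : 'rV[R]_N => step (a * x 0 i + b)).
Proof.
apply: elementary_mul; first exact: elementary_flat.
apply: elementary_inv; last by move=> x; rewrite gt_eqF// step_den_gt0.
apply: elementary_add; first exact: elementary_flat.
rewrite (_ : (fun _ => _) = fun x : 'rV[R]_N => flat 1 (- a * x 0 i + (1 - b))).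
  exact: elementary_flat.
by apply/funext => x; congr flat; rewrite opprD mulNr addrCA.
Qed.

Lemma elementary_prod (I : Type) (s : seq I) (f : I -> 'rV[R]_N -> R) :
  (forall i, elementary (f i)) -> elementary (fun x => \prod_(i <- s) f i x).
Proof.
move=> ef; elim: s => [|i s IH].
  under eq_fun do rewrite big_nil; exact: elementary_cst.
under eq_fun do rewrite big_cons; exact: elementary_mul.
Qed.

(** A ball of the sup norm is a product of intervals, so a product of one-dimensional transitions
    works: [a i] and [b i] are 1 when coordinate [i] is within [r] of the centre, and one of them is
    0 when it is at distance at least [2 * r]. *)
Lemma ball_cutoff c r : 0 < r -> exists eta : 'rV[R]_N -> R,
  [/\ elementary eta, forall x, 0 <= eta x <= 1,
      forall x, ball c r x -> eta x = 1 &
      forall x, eta x != 0 -> ball c (2 * r) x].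
Proof.
move=> r0.
pose a i x := step (- r^-1 * x 0 i + (2 + r^-1 * c 0 i)).
pose b i x := step (r^-1 * x 0 i + (2 - r^-1 * c 0 i)).
have aE i (x : 'rV[R]_N) : a i x = step (2 - r^-1 * (x 0 i - c 0 i)).
  by congr step; ring.
have bE i (x : 'rV[R]_N) : b i x = step (2 + r^-1 * (x 0 i - c 0 i)).
  by congr step; ring.
exists (fun x => \prod_(i <- enum 'I_N) (a i x * b i x)); split.
- apply: elementary_prod => i; apply: elementary_mul; exact: elementary_step.
- move=> x; elim: (enum _) => [|i s /andP[h0 h1]].
    by rewrite big_nil ler01 lexx.
  have /andP[k0 k1] : 0 <= a i x * b i x <= 1.
    by rewrite /a /b mulr_ge0 ?step_ge0// mulr_ile1 ?step_ge0 ?step_le1.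
  by rewrite big_cons mulr_ge0// mulr_ile1.
- move=> x /(mx_ballP _ _ r0) xc; rewrite big1_seq// => i _.
  have := xc i; rewrite distrC ltr_norml -(ltr_pM2l (_ : 0 < r^-1)) ?invr_gt0//.
  rewrite -[X in _ && X](ltr_pM2l (_ : 0 < r^-1)) ?invr_gt0// mulrN mulVf ?gt_eqF//.
  by move=> /andP[h1 h2]; rewrite aE bE !step_eq1 ?mulr1//; lra.
- move=> x; rewrite prodf_seq_neq0 => /allP H; apply/mx_ballP => [|i]; first by rewrite mulr_gt0.
  have := H i; rewrite mem_enum => /(_ isT) /=; rewrite aE bE.
  apply: contraNT; rewrite -leNgt distrC ler_normr.
  rewrite -!ler_pdivlMr//; case/orP; rewrite mulrC => h.
  + by rewrite (@step_eq0 (2 - _)) ?mul0r// subr_le0.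
  + by rewrite mulrN in h; rewrite (@step_eq0 (2 + _^-1 * _)) ?mulr0//; lra.
Qed.

End cutoff.

(** * Exhaustion of an open set by smooth cutoffs *)

Section exhaustion.
Context {R : realType} {N : nat}.
Implicit Types (V K : set 'rV[R]_N) (x : 'rV[R]_N).

(** The factor 3 leaves room for a function from [ball_cutoff], which lives in the ball of twice the
    radius, to have its closed support inside [V]. *)
Lemma rational_ball_subset V x : open V -> V x -> exists (q : 'rV[rat]_N) (m : nat),
  ball (map_mx ratr q : 'rV[R]_N) m.+1%:R^-1 x /\
  ball (map_mx ratr q : 'rV[R]_N) (3 * m.+1%:R^-1) `<=` V.
Proof.
move=> oV Vx; have /nbhs_ballP[e /= e0 eV] := open_nbhs_nbhs (conj oV Vx).
(* [x] is within one radius of the rational centre, so the ball of triple radius around that centre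
   lies within four radii of [x]. *)
have [m me] : exists m, m.+1%:R^-1 < e / 4 :> R.
  have e4 : 0 < e / 4 by rewrite divr_gt0.
  by have [m _ /(_ m (leqnn m))] := near_infty_natSinv_lt (PosNum e4); exists m.
have r0 : 0 < m.+1%:R^-1 :> R by rewrite invr_gt0.
have /choice[q Hq] : forall i, exists p : rat, `|ratr p - x 0 i| < m.+1%:R^-1.
  move=> i; have [|p] := @rat_in_itvoo _ (x 0 i - m.+1%:R^-1) (x 0 i + m.+1%:R^-1).
    by rewrite ltrBlDr -addrA ltrDl addr_gt0.
  by rewrite in_itv/= => pE; exists p; rewrite ltr_distl.
have xb : ball (map_mx ratr (\row_i q i) : 'rV[R]_N) m.+1%:R^-1 x.
  by apply/mx_ballP => // i; rewrite !mxE.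
exists (\row_i q i), m; split=> // y yb; apply: eV.
apply: (@le_ball _ _ _ (m.+1%:R^-1 + 3 * m.+1%:R^-1)); last first.
  exact: ball_triangle (ball_sym xb) yb.
rewrite -[X in X + _]mul1r -mulrDl mulrC -ler_pdivlMr//; move: (ltW me); congr (_ <= _ / _); lra.
Qed.

(** The index [k] codes a rational centre and a radius. A [k] that codes no ball whose triple lies
    in [V] receives the empty set and the zero function. *)
Lemma countable_cutoffs V : open V ->
  exists (B : nat -> set 'rV[R]_N) (eta : nat -> 'rV[R]_N -> R),
  (forall k, [/\ open (B k), relcompact (B k) V, elementary (eta k),
     relcompact [set x | eta k x != 0] V &
     forall x, 0 <= eta k x <= 1 /\ (B k x -> eta k x = 1)]) /\
  \bigcup_k B k = V.
Proof.
move=> oV.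
have H k : exists Be : set 'rV[R]_N * ('rV[R]_N -> R),
  [/\ open Be.1, relcompact Be.1 V, elementary Be.2,
     relcompact [set x | Be.2 x != 0] V &
     forall x, 0 <= Be.2 x <= 1 /\ (Be.1 x -> Be.2 x = 1)] /\
  forall (q : 'rV[rat]_N) (m : nat), pickle (q, m) = k ->
  ball (map_mx ratr q : 'rV[R]_N) (3 * m.+1%:R^-1) `<=` V ->
  ball (map_mx ratr q : 'rV[R]_N) m.+1%:R^-1 `<=` Be.1.
  have [[q [m [qm bV]]]|nH] := pselect (exists (q : 'rV[rat]_N) (m : nat),
     pickle (q, m) = k /\ ball (map_mx ratr q : 'rV[R]_N) (3 * m.+1%:R^-1) `<=` V).
    have r0 : 0 < m.+1%:R^-1 :> R by rewrite invr_gt0.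
    have [eta [ee eta01 eta1 etan0]] := ball_cutoff (map_mx ratr q : 'rV[R]_N) r0.
    exists (ball (map_mx ratr q : 'rV[R]_N) m.+1%:R^-1, eta); split; [split=> //=|].
    - exact: ball_open.
    - by apply: relcompact_ball bV; rewrite ltr_pMl// ltr1n.
    - apply: (relcompact_sub etan0); apply: relcompact_ball bV.
      by rewrite ltr_pM2r// ltr_nat.
    - by move=> x; split=> //; exact: eta1.
    by move=> q' m' E _; move: E; rewrite -qm => /(pcan_inj pickleK)[-> ->].
  exists (set0, fun=> 0); split; [split=> //=|].
  - exact: relcompact0.
  - exact: elementary_cst.
  - by rewrite (_ : [set _ | _] = set0)//; [exact: relcompact0|
      apply/seteqP; split=> // x /=; rewrite eqxx].
  - by move=> _; split=> //; rewrite lexx ler01.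
  by move=> q m qm bV; exfalso; apply: nH; exists q, m.
have [f Hf] := choice H.
exists (fun k => (f k).1), (fun k => (f k).2); split; first by move=> k; case: (Hf k).
apply/seteqP; split=> [x [k _]|x Vx].
  have [[_ [_ sV] _ _ _] _] := Hf k => fx; apply: sV; exact: subset_closure fx.
have [q [m [qx qV]]] := rational_ball_subset oV Vx.
exists (pickle (q, m)) => //; have [_ /(_ _ _ erefl qV)] := Hf (pickle (q, m)).
exact.
Qed.

(* Chosen so that [1 - cutoff_union eta n] is the product of the [1 - eta k], [k < n]. *)
Fixpoint cutoff_union (eta : nat -> 'rV[R]_N -> R) n : 'rV[R]_N -> R :=
  if n is m.+1 then fun x => cutoff_union eta m x +
    (eta m x + -1 * (cutoff_union eta m x * eta m x)) else fun=> 0.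

(** [W n] is the union of the first [n] balls. The increment of the cutoffs is [eta n] times
    [1 - cutoff_union eta n], hence nonnegative, which later allows monotone convergence; and the
    cutoff is 1 wherever one of its factors [eta k] is 1. *)
Lemma open_exhaustion V : open V ->
  exists (W : nat -> set 'rV[R]_N) (phi : nat -> 'rV[R]_N -> R),
  [/\ forall n, [/\ open (W n), relcompact (W n) V & test_function V (phi n)],
      forall n x, 0 <= phi n x <= 1 /\ phi n x <= phi n.+1 x,
      forall n m x, (n <= m)%N -> W n x -> phi m x = 1,
      forall n m, (n <= m)%N -> W n `<=` W m &
      \bigcup_n W n = V].
Proof.
move=> oV; have [B [eta [H BV]]] := countable_cutoffs oV.
pose W n := \big[setU/set0]_(k < n) B k.
have WS n : W n.+1 = W n `|` B n by rewrite /W big_ord_recr.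
have Wmono n m : (n <= m)%N -> W n `<=` W m.
  move=> nm; rewrite -(subnKC nm); elim: (m - n)%N => [|k IH]; first by rewrite addn0.
  by rewrite addnS WS; apply: subset_trans IH _; exact: subsetUl.
have phiW n x : 0 <= cutoff_union eta n x <= 1 /\ (W n x -> cutoff_union eta n x = 1).
  elim: n => [|n [/andP[h0 h1] IH]] /=.
    by split; [rewrite lexx ler01|rewrite /W big_ord0].
  have [_ _ _ _ /(_ x)[/andP[k0 k1] kB]] := H n; split.
    have : 0 <= (1 - cutoff_union eta n x) * (1 - eta n x) by rewrite mulr_ge0// subr_ge0.
    have : (1 - cutoff_union eta n x) * (1 - eta n x) <= 1 by rewrite mulr_ile1 ?subr_ge0//; lra.
    by move=> ? ?; apply/andP; split; lra.
  by rewrite WS => -[/IH->|/kB->]; lra.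
exists W, (cutoff_union eta); split=> //.
- move=> n; elim: n => [|n [oW cW [sW tW]]].
    rewrite /W big_ord0; split; [exact: open0|exact: relcompact0|split].
      exact/elementary_smooth/elementary_cst.
    by rewrite (_ : [set _ | _] = set0)//; [exact: relcompact0|
      apply/seteqP; split=> // x /=; rewrite eqxx].
  have [oB cB ee ce _] := H n; rewrite WS; split.
  + exact: openU.
  + exact: relcompactU.
  split.
    apply: elementary_smooth; move: n.+1; elim=> [|k IH] /=; first exact: elementary_cst.
    have [_ _ ek _ _] := H k.
    apply: elementary_add => //; apply: elementary_add => //.
    by apply: elementary_mul; [exact: elementary_cst|exact: elementary_mul].
  apply: relcompact_sub (relcompactU tW ce) => x /=.
  have [->|?] := eqVneq (cutoff_union eta n x) 0; last by left.
  by have [->|?] := eqVneq (eta n x) 0; [rewrite !(mulr0,addr0) eqxx|right].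
- move=> n x; have [/andP[k0 k1] _] := phiW n x; split; first by rewrite k0.
  have [_ _ _ _ /(_ x)[/andP[h0 h1] _]] := H n => /=.
  by rewrite lerDl mulN1r subr_ge0 ler_piMl.
- by move=> n m x nm Wx; case: (phiW m x) => _; apply; exact: Wmono Wx.
- rewrite -BV; apply/seteqP; split=> [x [n _]|x [n _ Bx]].
    by rewrite /W -bigcup_mkord => -[k kn Bx]; exists k.
  by exists n.+1 => //; rewrite WS; right.
Qed.

Lemma compact_sub_exhaustion K (W : nat -> set 'rV[R]_N) :
  (forall n, open (W n)) -> (forall n m, (n <= m)%N -> W n `<=` W m) ->
  compact K -> K `<=` \bigcup_n W n -> exists n, K `<=` W n.
Proof.
move=> oW mW; rewrite compact_cover => /(_ nat setT W) cK KW.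
have [|D _ KD] := cK _ KW; first by move=> i _; exact: oW.
exists (\max_(i <- finmap.enum_fset D) i)%N => x /KD[i iD Wx].
by apply: mW Wx; apply: leq_bigmax_seq.
Qed.

End exhaustion.

(** * Variations of locally finite measures *)

(** Trades equalities of differences for equalities of sums: a sum of measures is again a measure,
    to which uniqueness and integration lemmas apply. *)
Lemma fin_num_addB_eq {R : realDomainType} (a b c d : \bar R) :
  a \is a fin_num -> b \is a fin_num -> c \is a fin_num -> d \is a fin_num ->
  (a + d = b + c <-> c - d = a - b)%E.
Proof.
move: a b c d => [a||] [b||] [c||] [d||]// _ _ _ _.
by split=> -[h]; congr EFin; lra.
Qed.

Section variations.
Context {R : realType} {N : nat}.
Local Notation T := (Rn R N).
Variables (Omega : set T) (oOmega : open (Omega : set 'rV[R]_N)).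
Implicit Types (B F : set T) (mu : set T -> \bar R).
Local Open Scope ereal_scope.

Lemma open_measurable_Rn (V : set T) : open (V : set 'rV[R]_N) -> measurable V.
Proof. exact: sub_sigma_algebra. Qed.

Lemma relcompact_subset F : relcompact F Omega -> F `<=` Omega.
Proof. by move=> [_ cF] x Fx; apply: cF; exact: subset_closure. Qed.

Lemma borel_partition : exists D : nat -> set T,
  [/\ forall n, measurable (D n) /\ relcompact (D n) Omega, trivIset setT D &
      \bigcup_n D n = Omega].
Proof.
have [W [phi [HW _ _ _ WO]]] := open_exhaustion oOmega.
exists (seqDU W); split.
- move=> n; split.
    by apply: seqDU_measurable => k; apply: open_measurable_Rn; case: (HW k).
  by apply: (@relcompact_sub _ _ _ (W n)); [exact: subDsetl|case: (HW n)].
- exact: trivIset_seqDU.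
- by rewrite -seqDU_bigcup_eq.
Qed.

Lemma jordan_pos_restr (nu : {charge set T -> \bar R}) P Q
    (PQ : hahn_decomposition nu P Q) B :
  measurable B -> jordan_pos PQ B = nu (B `&` P).
Proof.
by move=> mB; rewrite jordan_posE cjordan_posE /crestr0 mem_set.
Qed.

Lemma jordan_neg_restr (nu : {charge set T -> \bar R}) P Q
    (PQ : hahn_decomposition nu P Q) B :
  measurable B -> jordan_neg PQ B = - nu (B `&` Q).
Proof.
by move=> mB; rewrite jordan_negE cjordan_negE /crestr0 mem_set.
Qed.

Lemma jordan_decompE (nu : {charge set T -> \bar R}) P Q
    (PQ : hahn_decomposition nu P Q) B : measurable B ->
  [/\ jordan_pos PQ B \is a fin_num, jordan_neg PQ B \is a fin_num &
      nu B = jordan_pos PQ B - jordan_neg PQ B].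
Proof.
move=> mB; split; [exact: fin_num_measure..|].
by rewrite {1}(jordan_decomp PQ)// /cadd/= /cscale mulN1e.
Qed.

Lemma charge_le_jordan_pos (nu : {charge set T -> \bar R}) P Q
    (PQ : hahn_decomposition nu P Q) B :
  measurable B -> nu B <= jordan_pos PQ B.
Proof.
move=> mB; rewrite (jordan_decomp PQ)// /cadd/= /cscale mulN1e.
by rewrite geeDl// oppe_le0.
Qed.

Lemma radon_loc_fin_num mu F : radon_loc Omega mu -> measurable F ->
  relcompact F Omega -> mu F \is a fin_num.
Proof.
move=> rmu mF cF; have [nu munu] := rmu F mF cF.
by rewrite munu// fin_num_measure.
Qed.

Lemma radon_locN mu : radon_loc Omega mu -> radon_loc Omega (fun B => - mu B).
Proof.
move=> rmu K mK cK; have [nu munu] := rmu K mK cK.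
by exists (copp nu) => B mB BK; rewrite munu.
Qed.

(* Cut Omega into relatively compact pieces; on each of them mu is a charge, and
   the upper variation is the sum of the positive parts of these charges. *)
Lemma upper_variation_measure mu : radon_loc Omega mu ->
  exists mp : {measure set T -> \bar R},
    forall B, measurable B -> upper_variation Omega mu B = mp B.
Proof.
move=> rmu; have [D [HD tD DO]] := borel_partition.
have mD n : measurable (D n) by case: (HD n).
have cD n : relcompact (D n) Omega by case: (HD n).
have [nu Hnu] := choice (fun n => rmu _ (mD n) (cD n)).
have /choice[P HP] : forall n, exists P, exists Q, hahn_decomposition (nu n) P Q.
  by move=> n; exact: Hahn_decomposition.
have {HP} [Q HPQ] := choice HP.
have mP n : measurable (P n) by have [[]] := HPQ n.
have aE n B : measurable B ->
    mrestr (jordan_pos (HPQ n)) (mD n) B = mu (B `&` D n `&` P n).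
  move=> mB; rewrite /mrestr jordan_pos_restr; last exact: measurableI.
  rewrite (Hnu n)//; first by apply: measurableI => //; exact: measurableI.
  by move=> x [[]].
exists (mseries (fun n => mrestr (jordan_pos (HPQ n)) (mD n)) 0) => B mB.
apply/eqP; rewrite eq_le; apply/andP; split.
- apply: ge_ereal_sup => _ [F [mF cF FB] <-].
  have [nuF HF] := rmu _ mF cF.
  have FE : \bigcup_n (F `&` D n) = F.
    by rewrite -setI_bigcupr DO; apply/setIidl; exact: relcompact_subset.
  have mFD n : measurable (F `&` D n) by exact: measurableI.
  have : (\sum_(0 <= i < n) nuF (F `&` D i)) @[n --> \oo] --> nuF (\bigcup_n (F `&` D n)).
    apply: charge_semi_sigma_additive => //.
      exact: trivIset_setIl.
    by rewrite FE.
  rewrite FE -HF// => cvF; rewrite -(cvg_lim _ cvF)//.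
  apply: lime_le; first by apply/cvg_ex; exists (mu F).
  apply: nearW => n; apply: (@le_trans _ _ (\sum_(0 <= k < n)
      mrestr (jordan_pos (HPQ k)) (mD k) B)); last first.
    by apply: nneseries_lim_ge => k _ _; exact: measure_ge0.
  apply: lee_sum => k _.
  rewrite -HF//.
  apply: (@le_trans _ _ (mrestr (jordan_pos (HPQ k)) (mD k) F)).
    rewrite /mrestr (Hnu k)//.
    exact: charge_le_jordan_pos.
  by apply: le_measure; rewrite ?inE.
- apply: lime_le.
    by apply: is_cvg_nneseries => k _ _; exact: measure_ge0.
  apply: nearW => n.
  (* Each partial sum is attained by [mu] on one set, the union of the positive parts of [B] in the
     first [n] pieces. Recording that [F] stays in those pieces gives disjointness from the next
     one. *)
  suff : exists F, [/\ measurable F, relcompact F Omega, F `<=` B `&` \bigcup_(k in `I_n) D k &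
      \sum_(0 <= k < n) mrestr (jordan_pos (HPQ k)) (mD k) B = mu F].
    move=> [F [mF cF FB ->]]; apply: ereal_sup_ubound; exists F => //; split=> //.
    by move=> x /FB[].
  elim: n => [|n [F [mF cF FB IH]]].
    exists set0; split=> //; first exact: relcompact0.
    have [nu0 ->//] := rmu _ measurable0 (@relcompact0 _ _ Omega).
    by rewrite charge0 big_geq.
  have mG : measurable (B `&` D n `&` P n) by apply: measurableI => //; exact: measurableI.
  have cG : relcompact (F `|` (B `&` D n `&` P n)) Omega.
    apply: relcompactU => //; apply: relcompact_sub (cD n) => x [[]//].
  exists (F `|` (B `&` D n `&` P n)); split=> //.
  + exact: measurableU.
  + move=> x [/FB[Bx [k /= kn Dx]]|[[Bx Dx] _]]; split=> //.
      by exists k => //=; exact: ltnW.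
    by exists n => /=.
  + rewrite big_nat_recr//= IH; have [nuG HG] := rmu _ (measurableU _ _ mF mG) cG.
    rewrite aE// !HG//; [|exact: measurableU].
    rewrite chargeU//; apply/seteqP; split=> // x [/FB[_ [k /= kn Dk]] [[_ Dn] _]].
    have := tD k n I I; move=> /(_ (ex_intro _ x (conj Dk Dn))) kE.
    by move: kn; rewrite kE ltnn.
Qed.

Lemma upper_variation_charge mu (nu : {charge set T -> \bar R}) P Q
    (PQ : hahn_decomposition nu P Q) F : measurable F -> relcompact F Omega ->
  (forall B, measurable B -> B `<=` F -> mu B = nu B) ->
  upper_variation Omega mu F = jordan_pos PQ F.
Proof.
move=> mF cF Hnu; have mP : measurable P by have [[]] := PQ.
apply/eqP; rewrite eq_le; apply/andP; split.
  apply: ge_ereal_sup => _ [G [mG cG GF] <-].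
  rewrite Hnu// (le_trans (charge_le_jordan_pos PQ mG))//.
  by apply: le_measure; rewrite ?inE.
apply: ereal_sup_ubound; exists (F `&` P).
  split; [exact: measurableI| |by move=> x []].
  by apply: relcompact_sub cF => x [].
by rewrite jordan_pos_restr// Hnu//; exact: measurableI.
Qed.

(** Passing to [- mu] swaps the two sets of a Hahn decomposition, so on a relatively compact set the
    lower variation is the negative part of the same charge. Signed integrals are computed later
    through these two measures. *)
Lemma jordan_loc mu : radon_loc Omega mu ->
  exists mp mn : {measure set T -> \bar R},
  (forall B, measurable B -> upper_variation Omega mu B = mp B /\
    lower_variation Omega mu B = mn B) /\
  (forall F, measurable F -> relcompact F Omega ->
    [/\ mp F < +oo, mn F < +oo & mu F = mp F - mn F]).
Proof.
move=> rmu; have [mp Hp] := upper_variation_measure rmu.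
have [mn Hn] := upper_variation_measure (radon_locN rmu).
exists mp, mn; split=> [B mB|F mF cF]; first by rewrite Hp// /lower_variation Hn.
have [nu Hnu] := rmu _ mF cF.
have [P [Q PQ]] := Hahn_decomposition nu.
have QP : hahn_decomposition (copp nu) Q P.
  have [[mP hP] [mQ hQ] PQT PQ0] := PQ; split.
  - by split=> // A mA AQ; rewrite /copp/= oppe_ge0; exact: hQ.
  - by split=> // A mA AQ; rewrite /copp/= oppe_le0; exact: hP.
  - by rewrite setUC.
  - by rewrite setIC.
rewrite -Hp// -Hn//.
rewrite (upper_variation_charge PQ)// (upper_variation_charge QP)//; last first.
  by move=> B mB BF; rewrite Hnu.
split; [by rewrite ltey_eq fin_num_measure..|].
rewrite Hnu// {1}(jordan_decomp PQ)// /cadd/= /cscale mulN1e; congr (_ - _).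
exact: etrans (jordan_neg_restr PQ mF) (esym (jordan_pos_restr QP mF)).
Qed.

Lemma eq_measure_relcompact (m1 m2 : {measure set T -> \bar R}) :
  (forall F, measurable F -> relcompact F Omega -> m1 F = m2 F) ->
  forall B, measurable B -> B `<=` Omega -> m1 B = m2 B.
Proof.
move=> H B mB BO; have [D [HD tD DO]] := borel_partition.
have <- : \bigcup_n (B `&` D n) = B.
  by rewrite -setI_bigcupr DO; exact/setIidl.
rewrite !measure_bigcup; [|by move=> i _; apply: measurableI => //; case: (HD i)|
  exact: trivIset_setIl|by move=> i _; apply: measurableI => //; case: (HD i)|
  exact: trivIset_setIl].
apply: eq_eseriesr => i _; have [mDi cDi] := HD i.
apply: H; first exact: measurableI.
by apply: relcompact_sub cDi => x [].
Qed.

Lemma radon_fin_loc mu : radon_fin Omega mu -> radon_loc Omega mu.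
Proof.
move=> [nu Hnu] K mK cK; exists nu => B mB BK; apply: Hnu => //.
exact: subset_trans (relcompact_subset cK).
Qed.

End variations.

Section euclidean_norm.
Context {R : realType} {n : nat}.
Implicit Types x : 'rV[R]_n.

Lemma enorm_ge0 x : 0 <= enorm x.
Proof. exact: sqrtr_ge0. Qed.

Lemma ler_enorm x i : `|x 0 i| <= enorm x.
Proof.
rewrite -sqrtr_sqr ler_wsqrtr// (bigD1 i)//= lerDl sumr_ge0// => j _.
exact: sqr_ge0.
Qed.

Lemma enorm_le_sum x : enorm x <= \sum_i `|x 0 i|.
Proof.
suff [S0 S2] : 0 <= \sum_i `|x 0 i| /\ \sum_i x 0 i ^+ 2 <= (\sum_i `|x 0 i|) ^+ 2.
  by rewrite -(ger0_norm S0) -sqrtr_sqr ler_wsqrtr.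
elim/big_rec2: _ => [|i a b _ [b0 ab]]; first by rewrite expr0n.
split; first by rewrite addr_ge0.
have : 0 <= `|x 0 i| * b by rewrite mulr_ge0.
rewrite -(real_normK (num_real (x 0 i))); nra.
Qed.

End euclidean_norm.

(** * Total variation of a vector measure *)

Section vector_variation.
Context {R : realType} {N k : nat}.
Local Notation T := (Rn R N).
Variables (Omega : set T) (oOmega : open (Omega : set 'rV[R]_N)).
Implicit Types (B F : set T) (A : 'I_k -> set T -> \bar R).
Local Open Scope ereal_scope.

(** [F] is completed to an admissible partition of [B] in [Omega] by cutting the rest of [B] along
    [borel_partition]; one term of a nonnegative series is at most its sum. *)
Lemma vector_variation_ge A B F : measurable B -> measurable F ->
  relcompact F Omega -> F `<=` B ->
  (enorm (\row_i fine (A i F)))%:E <= vector_variation Omega A B.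
Proof.
move=> mB mF cF FB; have [D [HD tD DO]] := borel_partition oOmega.
pose G n := if n is m.+1 then (B `\` F) `&` D m else F.
apply: (@le_trans _ _ (\sum_(n <oo) (enorm (\row_i fine (A i (G n))))%:E)).
  have := @nneseries_lim_ge R (fun n => (enorm (\row_i fine (A i (G n))))%:E) xpredT 0 1.
  by rewrite big_nat1; apply => n _ _; rewrite lee_fin enorm_ge0.
apply: ereal_sup_ubound; exists G => //; split.
- case=> [//|m]; have [mD cD] := HD m; split.
    by apply: measurableI => //; exact: measurableD.
  by apply: relcompact_sub cD => x [].
- move=> [|i] [|j] _ _ [x []] //=.
  + by move=> Fx [[_]].
  + by move=> [[_ nF] _] /nF.
  + by move=> [_ Di] [_ Dj]; congr _.+1; apply: (tD i j) => //; exists x.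
- apply/seteqP; split=> [x [[|m] _ /=]|x [Bx Ox]].
  + by move=> Fx; split; [exact: FB|exact: (relcompact_subset cF)].
  + by move=> [[Bx _] Dx]; split=> //; rewrite -DO; exists m.
  + have [Fx|nFx] := pselect (F x); first by exists 0%N.
    by move: Ox; rewrite -DO => -[m _ Dx]; exists m.+1.
Qed.

Lemma vector_variation_ge0 A B : measurable B -> 0 <= vector_variation Omega A B.
Proof.
move=> mB; apply: le_trans (vector_variation_ge A mB measurable0 _ _) => //.
- by rewrite lee_fin enorm_ge0.
- exact: relcompact0.
Qed.

Lemma le_vector_variation A i B F : radon_loc Omega (A i) -> measurable B ->
  measurable F -> relcompact F Omega -> F `<=` B ->
  `|A i F| <= vector_variation Omega A B.
Proof.
move=> rA mB mF cF FB; apply: le_trans (vector_variation_ge A mB mF cF FB).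
have -> : A i F = ((\row_j fine (A j F)) 0%R i)%:E.
  by rewrite mxE fineK//; exact: radon_loc_fin_num cF.
by rewrite lee_fin ler_enorm.
Qed.

Lemma upper_variation_le_vector A i B : radon_loc Omega (A i) -> measurable B ->
  upper_variation Omega (A i) B <= vector_variation Omega A B.
Proof.
move=> rA mB; apply: ge_ereal_sup => _ [F [mF cF FB] <-].
by apply: le_trans (le_vector_variation rA mB mF cF FB); exact: lee_abs.
Qed.

Lemma lower_variation_le_vector A i B : radon_loc Omega (A i) -> measurable B ->
  lower_variation Omega (A i) B <= vector_variation Omega A B.
Proof.
move=> rA mB; apply: ge_ereal_sup => _ [F [mF cF FB] <-].
apply: le_trans (le_vector_variation rA mB mF cF FB).
by rewrite -abseN; exact: lee_abs.
Qed.

(** A [density_measure] with respect to the total variation integrates against the upper variation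
    of [vector_variation], not against [vector_variation] itself; the components must be dominated
    in that form too. *)
Lemma upper_variation_le_upper_vector A i B : radon_loc Omega (A i) -> measurable B ->
  upper_variation Omega (A i) B <= upper_variation Omega (vector_variation Omega A) B.
Proof.
move=> rA mB; apply: ge_ereal_sup => _ [F [mF cF FB] <-].
apply: le_trans (lee_abs _) _; apply: le_trans (le_vector_variation rA mF mF cF _) _ => //.
by apply: ereal_sup_ubound; exists F.
Qed.

Lemma lower_variation_le_upper_vector A i B : radon_loc Omega (A i) -> measurable B ->
  lower_variation Omega (A i) B <= upper_variation Omega (vector_variation Omega A) B.
Proof.
move=> rA mB; apply: ge_ereal_sup => _ [F [mF cF FB] <-].
apply: le_trans (lee_abs _) _; rewrite abseN.
apply: le_trans (le_vector_variation rA mF mF cF _) _ => //.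
by apply: ereal_sup_ubound; exists F.
Qed.

(** The Euclidean norm is at most the sum of the absolute values of the components; sigma-additivity
    of [s] sums this bound over any admissible partition. *)
Lemma vector_variation_le A (s : {measure set T -> \bar R}) B :
  (forall F, measurable F -> relcompact F Omega -> \sum_i `|A i F| <= s F) ->
  (forall i, radon_loc Omega (A i)) ->
  measurable B -> vector_variation Omega A B <= s B.
Proof.
move=> As rA mB; apply: ge_ereal_sup => _ [F [HF tF FB] <-].
have mF n : measurable (F n) by case: (HF n).
have mBO : measurable (B `&` Omega).
  by apply: measurableI => //; exact: open_measurable_Rn.
apply: (@le_trans _ _ (s (B `&` Omega))); last first.
  by apply: le_measure; rewrite ?inE.
rewrite -FB measure_bigcup//.
have -> : \sum_(i <oo | i \in [set: nat]) s (F i) = \sum_(i <oo) s (F i).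
  by apply: eq_eseriesl => i; rewrite in_setT.
apply: lee_nneseries => [n _ _|n _]; first by rewrite lee_fin enorm_ge0.
have [_ cF] := HF n; apply: le_trans (As _ (mF n) cF).
rewrite (eq_bigr (fun i => (`|(\row_i fine (A i (F n))) 0%R i|%R)%:E)); last first.
  move=> i _; rewrite mxE -abse_EFin fineK//.
  exact: radon_loc_fin_num cF.
by rewrite sumEFin lee_fin enorm_le_sum.
Qed.

Lemma upper_vector_variation_le A (s : {measure set T -> \bar R}) B :
  (forall F, measurable F -> relcompact F Omega -> \sum_i `|A i F| <= s F) ->
  (forall i, radon_loc Omega (A i)) ->
  measurable B -> upper_variation Omega (vector_variation Omega A) B <= s B.
Proof.
move=> As rA mB; apply: ge_ereal_sup => _ [F [mF cF FB] <-].
apply: le_trans (vector_variation_le As rA mF) _.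
by apply: le_measure; rewrite ?inE.
Qed.

Lemma vector_variation_set0 A : (forall i, radon_loc Omega (A i)) ->
  vector_variation Omega A set0 = 0.
Proof.
move=> rA; apply/eqP; rewrite eq_le vector_variation_ge0// andbT.
apply: ge_ereal_sup => _ [F [HF tF FB] <-].
rewrite eseries0// => n _ _; have -> : F n = set0.
  apply/seteqP; split=> // x Fx; have : (set0 `&` Omega) x by rewrite -FB; exists n.
  by case.
congr EFin; rewrite /enorm big1 ?sqrtr0// => i _; rewrite mxE.
have [nu ->//] := rA i _ measurable0 (@relcompact0 _ _ Omega).
by rewrite charge0 expr0n.
Qed.

Lemma lower_vector_variation0 A B : (forall i, radon_loc Omega (A i)) ->
  measurable B -> lower_variation Omega (vector_variation Omega A) B = 0.
Proof.
move=> rA mB; apply/eqP; rewrite eq_le; apply/andP; split.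
  apply: ge_ereal_sup => _ [F [mF cF FB] <-].
  by rewrite oppe_le0 vector_variation_ge0.
apply: ereal_sup_ubound; exists set0.
  by split=> //; exact: relcompact0.
by rewrite vector_variation_set0// oppe0.
Qed.

End vector_variation.

(** * Integrals with respect to variations *)

(* The variations of the definitions are set functions without measure structure,
   so the library lemmas on integrals do not apply to them directly. *)
Section integral_set_function.
Context d (T : measurableType d) (R : realType).
Implicit Types (mu nu : set T -> \bar R) (D : set T) (f : T -> \bar R).
Local Open Scope ereal_scope.
Import HBNNSimple.

Lemma eq_integral_set_function mu nu D f :
  (forall B, measurable B -> mu B = nu B) -> integral mu D f = integral nu D f.
Proof.
move=> mn; have E (h : {nnsfun T >-> R}) : sintegral mu h = sintegral nu h.
  by apply: eq_fsbigr => r _; rewrite mn.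
by rewrite /integral; congr (ereal_sup _ - ereal_sup _);
  apply: eq_imagel => h _; exact: E.
Qed.

Lemma le_sintegral_set_function mu nu (h : {nnsfun T >-> R}) :
  mu set0 = 0 -> nu set0 = 0 -> (forall B, measurable B -> mu B <= nu B) ->
  sintegral mu h <= sintegral nu h.
Proof.
(* Dropping the values that [h] does not take leaves only nonnegative coefficients, so the sums can
   be compared term by term. *)
move=> mu0 nu0 mn; have E m : m set0 = 0 ->
    sintegral m h = \sum_(x \in range h) x%:E * m (h @^-1` [set x]).
  move=> m0; rewrite /sintegral; apply/esym/fsbig_widen => // x [_ /=].
  by move=> hx; rewrite preimage10// m0 mule0.
rewrite !E// lee_fsum// => _ [t _ <-].
by apply: lee_wpmul2l; [rewrite lee_fin|exact: mn].
Qed.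

Lemma nnintegral_set_function0 mu : mu set0 = 0 ->
  ereal_sup [set sintegral mu h | h in
    [set h : {nnsfun T >-> R} | forall x, (h x)%:E <= 0]] = 0.
Proof.
move=> mu0; have E (h : {nnsfun T >-> R}) : (forall x, (h x)%:E <= 0) -> sintegral mu h = 0.
  move=> h0; have {}h0 x : h x = 0%R by apply/eqP; rewrite eq_le fun_ge0 -lee_fin h0.
  rewrite /sintegral fsbig1// => r _; have [->|r0] := eqVneq r 0%R; first by rewrite mul0e.
  by rewrite (_ : _ @^-1` _ = set0) ?mu0 ?mule0//; apply/seteqP; split=> // x /=;
    rewrite h0 => /esym/eqP; rewrite (negbTE r0).
apply/eqP; rewrite eq_le; apply/andP; split.
  by apply: ge_ereal_sup => _ [h /= h0 <-]; rewrite E.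
apply: ereal_sup_ubound; exists nnsfun0; first by move=> x.
by apply: E => x.
Qed.

Lemma ge0_integral_set_functionE mu D f : mu set0 = 0 -> (forall x, D x -> 0 <= f x) ->
  integral mu D f = ereal_sup [set sintegral mu h | h in
    [set h : {nnsfun T >-> R} | forall x, (h x)%:E <= (f \_ D) x]].
Proof.
move=> mu0 f0; rewrite /integral.
have fD0 x : 0 <= (f \_ D) x by apply: erestrict_ge0.
have -> : (f \_ D)^\+ = f \_ D.
  by apply/funext => x; rewrite (@ge0_funeposE _ _ setT)// inE.
have -> : (f \_ D)^\- = cst 0.
  by apply/funext => x; rewrite (@ge0_funenegE _ _ setT)// inE.
by rewrite nnintegral_set_function0// sube0.
Qed.

Lemma ge0_le_integral_set_function mu nu D f : mu set0 = 0 -> nu set0 = 0 ->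
  (forall B, measurable B -> mu B <= nu B) -> (forall x, D x -> 0 <= f x) ->
  integral mu D f <= integral nu D f.
Proof.
move=> mu0 nu0 mn f0; rewrite !ge0_integral_set_functionE//.
apply: ge_ereal_sup => _ [h hf <-].
apply: (le_trans (le_sintegral_set_function h mu0 nu0 mn)).
by apply: ereal_sup_ubound; exists h.
Qed.

Lemma ge0_integralN_set_function mu D f : mu set0 = 0 -> (forall x, D x -> 0 <= f x) ->
  integral mu D (fun x => - f x) = - integral mu D f.
Proof.
move=> mu0 f0; rewrite [in RHS]ge0_integral_set_functionE// /integral.
have fD0 x : 0 <= (f \_ D) x by apply: erestrict_ge0.
have E : (fun x => - f x) \_ D = \- (f \_ D).
  by apply/funext => x; rewrite /patch; case: ifPn; rewrite ?oppe0.
have N0 x : setT x -> (\- (f \_ D)) x <= 0 by rewrite /= oppe_le0.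
rewrite E; have -> : (\- (f \_ D))^\+ = cst 0.
  by apply/funext => x; rewrite (le0_funeposE N0)// inE.
have -> : (\- (f \_ D))^\- = f \_ D.
  by apply/funext => x; rewrite (le0_funenegE N0) ?inE//= oppeK.
by rewrite nnintegral_set_function0// sub0e.
Qed.

End integral_set_function.

Section density.
Context d (T : measurableType d) (R : realType) (m : {measure set T -> \bar R}).
Local Open Scope ereal_scope.
Import HBNNSimple.

Section measure_of_density.
Variables (w : T -> \bar R) (mw : measurable_fun [set: T] w) (w0 : forall x, 0 <= w x).

(** The proofs of measurability and nonnegativity are arguments so that the term itself carries what
    its measure structure needs. *)
Definition measure_of_density (_ : measurable_fun [set: T] w) (_ : forall x, 0 <= w x)
  (B : set T) : \bar R := \int[m]_(x in B) w x.

Local Notation wm := (measure_of_density mw w0).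

Let wm0 : wm set0 = 0. Proof. exact: integral_set0. Qed.

Let wm_ge0 B : 0 <= wm B. Proof. exact: integral_ge0. Qed.

Let wm_sigma_additive : semi_sigma_additive wm.
Proof. exact: semi_sigma_additive_nng_induced. Qed.

HB.instance Definition _ := isMeasure.Build _ _ _ wm wm0 wm_ge0 wm_sigma_additive.

(** Multiplication is not continuous at 0 times infinity. The bound [a n <= l] excludes the bad
    case: if [l] is 0, every [a n] is 0. *)
Lemma cvge_monotone_mul (a : nat -> R) (l c : \bar R) : 0 <= c ->
  (forall n, (0 <= a n)%R) -> (forall n, (a n)%:E <= l) ->
  (a n)%:E @[n --> \oo] --> l -> (a n)%:E * c @[n --> \oo] --> l * c.
Proof.
move=> c0 a0 al cvl; have [cfin|] := boolP (c \is a fin_num); first exact: cvgeZr.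
rewrite ge0_fin_numE// -leNgt leye_eq => /eqP ->.
have l0 : 0 <= l by apply: le_trans (al 0%N); rewrite lee_fin.
move: l0; rewrite le_eqVlt => /predU1P[l0|l0].
  rewrite -l0 mul0e (_ : (fun n => _) = cst 0); first exact: cvg_cst.
  apply/funext => n /=; rewrite (_ : a n = 0%R) ?mul0e//.
  by apply/eqP; rewrite eq_le a0 andbT -lee_fin; move: (al n); rewrite -l0.
rewrite gt0_muley//; apply: cvg_near_cst.
have [K _ HK] := cvl _ (open_ereal_gt' l0).
by exists K => // n /= Kn; rewrite gt0_muley//; exact: HK.
Qed.

Lemma integral_measure_of_density (f : T -> \bar R) :
  measurable_fun setT f -> (forall x, 0 <= f x) ->
  \int[wm]_x f x = \int[m]_x (f x * w x).
Proof.
move=> mf f0; pose h := nnsfun_approx measurableT mf.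
have hf n x : (h n x)%:E <= f x by rewrite nnsfun_approxE le_approx.
have hcv x : (h n x)%:E @[n --> \oo] --> f x by exact: cvg_nnsfun_approx.
have hnd x : {homo (fun n => (h n x)%:E) : a b / (a <= b)%N >-> a <= b}.
  by move=> a b ab; rewrite lee_fin; exact/lefP/nd_nnsfun_approx.
have mh n : measurable_fun setT (EFin \o h n).
  by apply/measurable_EFinP; exact/measurable_funP.
transitivity (limn (fun n => \int[wm]_x (h n x)%:E)).
  have fE x : f x = limn (fun n => (h n x)%:E) by apply/esym/cvg_lim.
  under eq_integral do rewrite fE.
  apply: monotone_convergence => //.
  by move=> n x _; rewrite lee_fin.
transitivity (limn (fun n => \int[m]_x ((h n x)%:E * w x))); last first.
  have fE x : f x * w x = limn (fun n => (h n x)%:E * w x).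
    by apply/esym/cvg_lim => //; exact: cvge_monotone_mul.
  under [RHS]eq_integral do rewrite fE.
  apply/esym/monotone_convergence => //.
  - by move=> n; exact: (emeasurable_funM (mh n) mw).
  - by move=> n x _; rewrite mule_ge0 ?lee_fin.
  - by move=> x _ a b ab; apply: lee_wpmul2r => //; exact: hnd.
congr (limn _); apply/funext => n.
rewrite integralT_nnsfun sintegralE.
under [RHS]eq_integral => x _.
  rewrite (fimfunE (h n) x) -fsumEFin// ge0_mule_fsuml; last first.
    by move=> r; exact: nnfun_muleindic_ge0.
  over.
rewrite ge0_integral_fsum//; last 2 first.
- move=> r; apply: emeasurable_funM => //; apply/measurable_EFinP.
  by apply: measurable_funM => //.
- by move=> r x _; rewrite mule_ge0// nnfun_muleindic_ge0.
apply: eq_fsbigr => r; rewrite inE => -[t _ <-].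
under [RHS]eq_integral do rewrite EFinM -muleA.
rewrite ge0_integralZl//; last 3 first.
- by apply: emeasurable_funM => //; exact/measurable_EFinP.
- by move=> x _; rewrite mule_ge0// lee_fin.
- by rewrite lee_fin.
congr (_ * _); transitivity (\int[m]_(x in h n @^-1` [set h n t]) w x) => //.
by rewrite integral_mkcond; apply: eq_integral => x _; rewrite epatch_indic muleC.
Qed.

End measure_of_density.

End density.

Section signed_density.
Context d (T : measurableType d) (R : realType).
Implicit Types (m : {measure set T -> \bar R}) (D : set T) (f g w : T -> \bar R).
Local Open Scope ereal_scope.

(** Valid for infinite values as well: for each pair of signs at most one of the two products is
    nonzero, so the sum is never indeterminate. *)
Lemma funepos_mul w g x :
  (fun y => w y * g y)^\+ x = g^\+ x * w^\+ x + g^\- x * w^\- x.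
Proof.
rewrite !(funeposE, funenegE) /=; have /orP[g0|g0] := le_total 0 (g x);
  have /orP[w0|w0] := le_total 0 (w x).
- rewrite (max_l g0) (max_l w0) (max_r (_ : - g x <= 0)) ?oppe_le0//.
  by rewrite mul0e adde0 muleC max_l// mule_ge0.
- rewrite (max_l g0) (max_r w0) (max_r (_ : - g x <= 0)) ?oppe_le0//.
  by rewrite mul0e mule0 adde0 max_r// mule_le0_ge0.
- rewrite (max_r g0) (max_l w0) (max_r (_ : - w x <= 0)) ?oppe_le0//.
  by rewrite mul0e mule0 adde0 max_r// mule_ge0_le0.
- rewrite (max_r g0) (max_r w0) !max_l ?oppe_ge0//; last by rewrite mule_le0.
  by rewrite mul0e add0e muleNN muleC.
Qed.

Lemma funeneg_mul w g x :
  (fun y => w y * g y)^\- x = g^\- x * w^\+ x + g^\+ x * w^\- x.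
Proof.
have -> : (fun y => w y * g y)^\- x = (fun y => w y * - g y)^\+ x.
  by rewrite funeposE funenegE muleN.
rewrite funepos_mul; congr (_ * _ + _ * _).
  by rewrite funeposE funenegE.
by rewrite funeposE funenegE oppeK.
Qed.

Lemma bounded_integrable m D g (C : R) : measurable D -> m D < +oo ->
  measurable_fun D g -> (forall x, D x -> `|g x| <= C%:E) -> m.-integrable D g.
Proof.
move=> mD mfin mg gC; apply/integrableP; split=> //.
apply: (@le_lt_trans _ _ (\int[m]_(x in D) (Num.max C 0)%:E)).
  apply: ge0_le_integral => //.
  - exact: measurableT_comp.
  - by move=> x Dx; apply: le_trans (gC x Dx) _; rewrite lee_fin le_max lexx.
rewrite integral_cst//= lte_mul_pinfty// lee_fin le_max lexx orbT//.
Qed.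

Lemma integrable_le_set_function m (nu : set T -> \bar R) D f : nu set0 = 0 ->
  (forall B, measurable B -> m B <= nu B) -> nu.-integrable D f -> m.-integrable D f.
Proof.
move=> nu0 mnu /integrableP[mf fi]; apply/integrableP; split=> //.
by apply: le_lt_trans fi; exact: ge0_le_integral_set_function.
Qed.

(** The two measures have densities the positive and negative parts of [w], cut off to 0 outside
    [D]; integrability of [w] makes both finite, and then every bounded [g] is integrable against
    them. *)
Lemma integrable_density_rep m D w : measurable D -> m.-integrable D w ->
  exists m1 m2 : {measure set T -> \bar R},
  [/\ m1 setT < +oo, m2 setT < +oo,
     forall B, measurable B -> \int[m]_(x in B `&` D) w x = m1 B - m2 B &
     forall g (C : R), measurable_fun D g -> (forall x, D x -> `|g x| <= C%:E) ->
       \int[m]_(x in D) (w x * g x) = \int[m1]_(x in D) g x - \int[m2]_(x in D) g x].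
Proof.
move=> mD iw; pose v := w \_ D.
have iv : m.-integrable setT v by apply/integrable_restrict => //; rewrite setTI.
have mv : measurable_fun setT v by case/integrableP: iv.
have mvp : measurable_fun setT v^\+ by exact: measurable_funepos.
have mvn : measurable_fun setT v^\- by exact: measurable_funeneg.
have vp0 x : 0 <= v^\+ x by exact: funepos_ge0.
have vn0 x : 0 <= v^\- x by exact: funeneg_ge0.
have m1fin : measure_of_density m mvp vp0 setT < +oo.
  by rewrite ltey_eq; apply/orP; left; exact: integrable_pos_fin_num.
have m2fin : measure_of_density m mvn vn0 setT < +oo.
  by rewrite ltey_eq; apply/orP; left; exact: integrable_neg_fin_num.
exists (measure_of_density m mvp vp0), (measure_of_density m mvn vn0).
split=> //.
  by move=> B mB; rewrite integral_mkcondr integralE.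
move=> g C mg gC; pose h := g \_ D.
have mh : measurable_fun setT h by apply/(measurable_restrictT _ mD).
have hC x : `|h x| <= (Num.max C 0)%:E.
  rewrite /h /patch; case: ifPn => [/[!inE] Dx|_].
    by apply: le_trans (gC x Dx) _; rewrite lee_fin le_max lexx.
  by rewrite abse0 lee_fin le_max lexx orbT.
rewrite !(integral_mkcond D) -/h.
have -> : (fun x => w x * g x) \_ D = (fun x => v x * h x).
  by apply/funext => x; rewrite /v /h /patch; case: ifPn => //; rewrite mule0.
have mhp : measurable_fun setT h^\+ by exact: measurable_funepos.
have mhn : measurable_fun setT h^\- by exact: measurable_funeneg.
rewrite integralE [X in _ = X - _]integralE [X in _ = _ - X]integralE.
under eq_integral do rewrite funepos_mul.
under [X in _ - X = _]eq_integral do rewrite funeneg_mul.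
rewrite !ge0_integralD//; try (by move=> x _; rewrite mule_ge0);
  try exact: emeasurable_funM.
rewrite -!integral_measure_of_density//.
have fin (n : {measure set T -> \bar R}) : n setT < +oo ->
    \int[n]_x h^\+ x \is a fin_num /\ \int[n]_x h^\- x \is a fin_num.
  move=> nfin; have ih : n.-integrable setT h.
    exact: (@bounded_integrable n setT h (Num.max C 0%R) measurableT nfin mh (fun x _ => hC x)).
  by split; [exact: integrable_pos_fin_num|exact: integrable_neg_fin_num].
have [/= a1 a2] := fin _ m1fin; have [/= b1 b2] := fin _ m2fin.
move: a1 a2 b1 b2; set A1 := integral _ _ _; set A2 := integral _ _ _.
set B1 := integral _ _ _; set B2 := integral _ _ _.
move: A1 A2 B1 B2 => [A1||] [A2||] [B1||] [B2||]// _ _ _ _.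
congr EFin; ring.
Qed.

End signed_density.

Section signed_integral_lemmas.
Context {R : realType} {N : nat}.
Local Notation T := (Rn R N).
Variables (Omega : set T) (oOmega : open (Omega : set 'rV[R]_N)).
Implicit Types (B F : set T) (mu nu : set T -> \bar R) (f g w : T -> \bar R).
Local Open Scope ereal_scope.

Let mOmega : measurable Omega. Proof. exact: open_measurable_Rn. Qed.

Lemma eq_signed_integral mu D f g : {in D, f =1 g} ->
  signed_integral Omega mu D f = signed_integral Omega mu D g.
Proof. by move=> /eq_restrictP fg; rewrite /signed_integral /integral fg. Qed.

Lemma eq_upper_variation mu nu B :
  (forall F, measurable F -> relcompact F Omega -> mu F = nu F) ->
  upper_variation Omega mu B = upper_variation Omega nu B.
Proof.
move=> mn; congr ereal_sup; apply: eq_imagel => F [mF cF _]; exact: mn.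
Qed.

Lemma eq_signed_integral_relcompact mu nu D f :
  (forall F, measurable F -> relcompact F Omega -> mu F = nu F) ->
  signed_integral Omega mu D f = signed_integral Omega nu D f.
Proof.
move=> mn; rewrite /signed_integral /lower_variation.
have -> : upper_variation Omega mu = upper_variation Omega nu.
  by apply/funext => B; exact: eq_upper_variation.
suff -> : upper_variation Omega (fun B => - mu B) =
          upper_variation Omega (fun B => - nu B) by [].
by apply/funext => B; apply: eq_upper_variation => F mF cF; rewrite mn.
Qed.

(** The variations are the smallest possible pair, [mp <= m1] and [mn <= m2], so [f] is integrable
    for them. On relatively compact sets [m1 + mn = m2 + mp]; this extends to Borel subsets of
    [Omega], and the integrals are rearranged. *)
Lemma signed_integral_pair mu (m1 m2 : {measure set T -> \bar R}) f :
  radon_loc Omega mu ->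
  (forall F, measurable F -> relcompact F Omega ->
     [/\ m1 F < +oo, m2 F < +oo & mu F = m1 F - m2 F]) ->
  m1.-integrable Omega f -> m2.-integrable Omega f ->
  signed_integral Omega mu Omega f =
    \int[m1]_(x in Omega) f x - \int[m2]_(x in Omega) f x.
Proof.
move=> rmu H i1 i2; have [mp [mn [Hv Hf]]] := jordan_loc oOmega rmu.
have pm1 B : measurable B -> mp B <= m1 B.
  move=> mB; have [<- _] := Hv B mB; apply: ge_ereal_sup => _ [F [mF cF FB] <-].
  have [_ _ ->] := H F mF cF; apply: (@le_trans _ _ (m1 F)).
    by rewrite geeDl// oppe_le0.
  by apply: le_measure; rewrite ?inE.
have nm2 B : measurable B -> mn B <= m2 B.
  move=> mB; have [_ <-] := Hv B mB; apply: ge_ereal_sup => _ [F [mF cF FB] <-].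
  have [h1 h2 ->] := H F mF cF; apply: (@le_trans _ _ (m2 F)).
    rewrite fin_num_oppeB//; last by rewrite ge0_fin_numE.
    by rewrite addeC geeDl// oppe_le0.
  by apply: le_measure; rewrite ?inE.
have ip : mp.-integrable Omega f by exact: (integrable_le_set_function (measure0 m1) pm1 i1).
have in_ : mn.-integrable Omega f by exact: (integrable_le_set_function (measure0 m2) nm2 i2).
have -> : signed_integral Omega mu Omega f =
    \int[mp]_(x in Omega) f x - \int[mn]_(x in Omega) f x.
  by rewrite /signed_integral; congr (_ - _); apply: eq_integral_set_function => B mB;
    case: (Hv B mB).
apply: (fin_num_addB_eq (integrable_fin_num mOmega i1) (integrable_fin_num mOmega i2)
  (integrable_fin_num mOmega ip) (integrable_fin_num mOmega in_)).1.
rewrite -!integral_measure_add//; apply: eq_measure_integral => B mB BO.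
suff E F : measurable F -> relcompact F Omega -> measure_add m1 mn F = measure_add m2 mp F.
  exact: eq_measure_relcompact BO.
move=> mF cF; rewrite !measure_addE.
have [h1 h2 mu1] := H F mF cF; have [k1 k2 mu2] := Hf F mF cF.
apply: (fin_num_addB_eq _ _ _ _).2; rewrite ?ge0_fin_numE//.
by rewrite -mu1 -mu2.
Qed.

End signed_integral_lemmas.

(** * Signed integrals and uniqueness *)

(* Rewriting does not find [measure_add] under the coercion of its measure structure. *)
Lemma packed_measure_addE d (T : measurableType d) (R : realType)
    (m1 m2 : {measure set T -> \bar R}) B :
  ((measure_add m1 m2 : {measure set T -> \bar R}) B = m1 B + m2 B)%E.
Proof. exact: measure_addE. Qed.

Section represented.
Context {R : realType} {N : nat}.
Local Notation T := (Rn R N).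
Variables (Omega : set T) (oOmega : open (Omega : set 'rV[R]_N)).
Implicit Types (B F : set T) (mu nu : set T -> \bar R) (f g w : T -> \bar R).
Implicit Types m : {measure set T -> \bar R}.
Local Open Scope ereal_scope.

Let mOmega : measurable Omega. Proof. exact: open_measurable_Rn. Qed.

(** The two measures need not be mutually singular, so the notion is stable under sums without
    computing a new Jordan decomposition. *)
Definition difference_of mu m1 m2 := [/\ m1 Omega < +oo, m2 Omega < +oo &
  forall B, measurable B -> B `<=` Omega -> mu B = m1 B - m2 B].

Lemma le_measure_Omega m B : measurable B -> B `<=` Omega -> m Omega < +oo -> m B < +oo.
Proof.
by move=> mB BO; apply: le_lt_trans; apply: le_measure; rewrite ?inE.
Qed.

Lemma difference_radon_fin mu m1 m2 : difference_of mu m1 m2 -> radon_fin Omega mu.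
Proof.
move=> [fin1 fin2 muE].
pose n1 := charge_of_finite_measure (mfrestr mOmega fin1).
pose n2 := charge_of_finite_measure (mfrestr mOmega fin2).
exists (cadd n1 (copp n2)) => B mB BO.
transitivity (m1 (B `&` Omega) - m2 (B `&` Omega)) => //.
by rewrite (setIidl BO) muE.
Qed.

Lemma radon_fin_difference mu : radon_fin Omega mu -> exists m1 m2, difference_of mu m1 m2.
Proof.
move=> [nu Hnu]; have [P [Q PQ]] := Hahn_decomposition nu.
exists (jordan_pos PQ), (jordan_neg PQ).
have [p q _] := jordan_decompE PQ mOmega.
split; [by rewrite ltey_eq p|by rewrite ltey_eq q|move=> B mB BO].
by have [_ _ <-] := jordan_decompE PQ mB; rewrite Hnu.
Qed.

Lemma difference_loc mu m1 m2 : difference_of mu m1 m2 ->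
  forall F, measurable F -> relcompact F Omega ->
     [/\ m1 F < +oo, m2 F < +oo & mu F = m1 F - m2 F].
Proof.
move=> [fin1 fin2 muE] F mF /relcompact_subset FO.
by split; [exact: le_measure_Omega|exact: le_measure_Omega|exact: muE].
Qed.

Lemma difference_signed_integral mu m1 m2 g (C : R) : difference_of mu m1 m2 ->
  measurable_fun Omega g -> (forall x, Omega x -> `|g x| <= C%:E) ->
  signed_integral Omega mu Omega g = \int[m1]_(x in Omega) g x - \int[m2]_(x in Omega) g x.
Proof.
move=> mu12 mg gC; have [fin1 fin2 _] := mu12.
apply: signed_integral_pair => //.
- exact/radon_fin_loc/difference_radon_fin/mu12.
- exact: difference_loc.
- exact: bounded_integrable gC.
- exact: bounded_integrable gC.
Qed.

Lemma differenceD mu nu m1 m2 n1 n2 : difference_of mu m1 m2 ->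
  difference_of nu n1 n2 ->
  difference_of (fun B => mu B + nu B) (measure_add m1 n1) (measure_add m2 n2).
Proof.
move=> [m1f m2f muE] [n1f n2f nuE].
split; [by rewrite packed_measure_addE lte_add_pinfty|by rewrite packed_measure_addE lte_add_pinfty|].
move=> B mB BO; rewrite muE// nuE// !packed_measure_addE.
have fB m : m Omega < +oo -> m B \is a fin_num.
  by move=> mf; rewrite ge0_fin_numE// le_measure_Omega.
move: (fB _ m1f) (fB _ m2f) (fB _ n1f) (fB _ n2f).
move: (m1 B) (m2 B) (n1 B) (n2 B) => [a||] [b||] [c||] [e||]// _ _ _ _.
congr EFin; ring.
Qed.

Lemma weighted_difference k (A : 'I_k -> set T -> \bar R) i w :
  (forall j, radon_loc Omega (A j)) -> (vector_variation Omega A).-integrable Omega w ->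
  exists m1 m2, difference_of (density_measure Omega w (A i)) m1 m2 /\
    forall g (C : R), measurable_fun Omega g -> (forall x, Omega x -> `|g x| <= C%:E) ->
    signed_integral Omega (A i) Omega (fun x => w x * g x) =
      \int[m1]_(x in Omega) g x - \int[m2]_(x in Omega) g x.
Proof.
move=> rA iw; have [mp [mn [Hv Hf]]] := jordan_loc oOmega (rA i).
have vv0 := vector_variation_set0 oOmega rA.
have ip : mp.-integrable Omega w.
  apply: (integrable_le_set_function vv0 _ iw) => B mB.
  by have [<- _] := Hv B mB; exact: upper_variation_le_vector.
have in_ : mn.-integrable Omega w.
  apply: (integrable_le_set_function vv0 _ iw) => B mB.
  by have [_ <-] := Hv B mB; exact: lower_variation_le_vector.
have [p1 [p2 [p1f p2f pE pI]]] := integrable_density_rep mOmega ip.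
have [n1 [n2 [n1f n2f nE nI]]] := integrable_density_rep mOmega in_.
have sE D f : signed_integral Omega (A i) D f =
    \int[mp]_(x in D) f x - \int[mn]_(x in D) f x.
  by rewrite /signed_integral; congr (_ - _); apply: eq_integral_set_function => B mB;
    case: (Hv B mB).
have finB m B : m setT < +oo -> measurable B -> m B \is a fin_num.
  move=> mf mB; rewrite ge0_fin_numE// (le_lt_trans _ mf)//.
  by apply: le_measure; rewrite ?inE.
have alg (a b c e : \bar R) : a \is a fin_num -> b \is a fin_num -> c \is a fin_num ->
    e \is a fin_num -> (a - b) - (c - e) = (a + e) - (b + c).
  by move: a b c e => [a||] [b||] [c||] [e||]// _ _ _ _; congr EFin; ring.
(* By the sign rule the positive side collects [w^\+] against [mp] and [w^\-] against [mn], the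
   negative side the two mixed terms. *)
exists (measure_add p1 n2), (measure_add p2 n1); split; [split|].
- by rewrite packed_measure_addE ltey_eq fin_numD !finB.
- by rewrite packed_measure_addE ltey_eq fin_numD !finB.
- move=> B mB BO; rewrite /density_measure sE pE// nE// !packed_measure_addE.
  by rewrite alg// finB.
- move=> g C mg gC; rewrite sE (pI g C)// (nI g C)//.
  have ig m : m setT < +oo -> m.-integrable Omega g.
    move=> mf; apply: (@bounded_integrable _ _ _ m Omega g C) => //.
    by apply: le_lt_trans mf; apply: le_measure; rewrite ?inE.
  rewrite !integral_measure_add//; [|exact: ig..].
  by rewrite alg//; apply: integrable_fin_num => //; exact: ig.
Qed.

End represented.

(** * Measures determined by test functions *)

Section uniqueness.
Context {R : realType} {N : nat}.
Local Notation T := (Rn R N).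
Implicit Types (V B F : set T) (a b m : {measure set T -> \bar R}).
Local Open Scope ereal_scope.

Lemma continuous_measurable_Rn (phi : 'rV[R]_N -> R) (D : set T) : measurable D ->
  continuous phi -> measurable_fun D (phi : T -> R).
Proof.
move=> mD /continuousP cphi; apply: (@measurable_funS _ _ _ _ setT) => //.
apply: (measurability _ (RGenOpens.measurableE R)) => _ [_ [x [y ->] <-]].
rewrite setTI; apply: open_measurable_Rn; apply: cphi; exact: interval_open.
Qed.

Lemma test_function_continuous (V : set 'rV[R]_N) (phi : 'rV[R]_N -> R) :
  test_function V phi -> continuous phi.
Proof. by move=> [/(_ [::])[]]. Qed.

Lemma test_function_eq0 (V : set 'rV[R]_N) (phi : 'rV[R]_N -> R) x :
  test_function V phi -> ~ V x -> phi x = 0%R.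
Proof.
move=> [_ [_ sV]] nVx; apply: contra_notP nVx => /eqP phix.
by apply: sV; exact: subset_closure.
Qed.

Lemma test_functionS (U V : set 'rV[R]_N) (phi : 'rV[R]_N -> R) :
  U `<=` V -> test_function U phi -> test_function V phi.
Proof. by move=> UV [sphi [bphi cphi]]; split=> //; split=> // x /cphi/UV. Qed.

Lemma cvg_integral_test (V U : set T) (phi : nat -> 'rV[R]_N -> R) m : measurable V ->
  (forall n, test_function U (phi n)) ->
  (forall n x, 0 <= phi n x <= 1 /\ phi n x <= phi n.+1 x)%R ->
  (forall x, U x -> \forall n \near \oo, phi n x = 1%R) -> measurable U ->
  \int[m]_(x in V) (phi n x)%:E @[n --> \oo] --> m (V `&` U).
Proof.
move=> mV tphi phi01 phi1 mU.
pose h n (x : T) := (phi n x)%:E.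
have mh n : measurable_fun V (h n).
  apply/measurable_EFinP; apply: continuous_measurable_Rn => //.
  exact: test_function_continuous (tphi n).
have h0 n x : V x -> 0 <= h n x.
  by move=> _; rewrite lee_fin; have [/andP[]] := phi01 n x.
have hnd x : V x -> {homo h^~ x : a b / (a <= b)%N >-> a <= b}.
  move=> _; apply/nondecreasing_seqP => n; rewrite lee_fin.
  by have [] := phi01 n x.
suff <- : \int[m]_(x in V) limn (h^~ x) = m (V `&` U).
  exact: (cvg_monotone_convergence mV mh h0 hnd).
rewrite setIC -integral_indic//; apply: eq_integral => x _.
apply/cvg_lim => //; rewrite indicE; have [Ux|nUx] := pselect (U x).
  rewrite mem_set//; apply: cvg_near_cst; have [n _ Hn] := phi1 x Ux.
  by exists n => // k /= nk; rewrite /h Hn.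
rewrite memNset// (_ : (fun n => _) = cst 0); first exact: cvg_cst.
by apply/funext => n; rewrite /h (test_function_eq0 (tphi n) nUx).
Qed.

Lemma exhaustion_near (W : nat -> set 'rV[R]_N) (phi : nat -> 'rV[R]_N -> R) x :
  (forall n k x, (n <= k)%N -> W n x -> phi k x = 1%R) -> (\bigcup_n W n) x ->
  \forall n \near \oo, phi n x = 1%R.
Proof. by move=> H [n _ Wx]; exists n => // k /= nk; exact: H Wx. Qed.

(** On an open set both measures are limits of integrals of the same increasing cutoffs, so they
    agree there; Borel sets are reached from open sets by uniqueness of measures on a generating
    pi-system. *)
Lemma measure_test_unique V a b : open (V : set 'rV[R]_N) ->
  (forall F, measurable F -> relcompact F V -> a F < +oo) ->
  (forall phi, test_function V phi -> (forall x, 0 <= phi x <= 1)%R ->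
    \int[a]_(x in V) (phi x)%:E = \int[b]_(x in V) (phi x)%:E) ->
  forall B, measurable B -> B `<=` V -> a B = b B.
Proof.
move=> oV afin ab; have mV : measurable V := open_measurable_Rn oV.
have abo (U : set T) : open (U : set 'rV[R]_N) -> U `<=` V -> a U = b U.
  move=> oU UV; have mU : measurable U := open_measurable_Rn oU.
  have [W [phi [HW phi01 phi1 _ WU]]] := open_exhaustion oU.
  have tphi n : test_function U (phi n) by case: (HW n).
  have phin x : U x -> \forall n \near \oo, phi n x = 1%R.
    by rewrite -WU; exact: exhaustion_near.
  have cva := @cvg_integral_test V U phi a mV tphi phi01 phin mU.
  have cvb := @cvg_integral_test V U phi b mV tphi phi01 phin mU.
  rewrite (setIidr UV) in cva cvb; apply: cvg_unique cva _ => //.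
  have -> // : (fun n => \int[a]_(x in V) (phi n x)%:E) =
               (fun n => \int[b]_(x in V) (phi n x)%:E).
  apply/funext => n; apply: ab; first exact: test_functionS (tphi n).
  by move=> x; case: (phi01 n x).
(* Restricting both measures to some [W n] that contains [F] provides the finite mass required by
   uniqueness. *)
apply: (eq_measure_relcompact oV) => F mF cF.
have [W [phi [HW _ _ mW WV]]] := open_exhaustion oV.
have [n FW] : exists n, closure F `<=` W n.
  apply: compact_sub_exhaustion => //; first by move=> n; case: (HW n).
    exact: relcompact_compact cF.
  by rewrite WV; case: cF.
have [oW cW _] := HW n; have mWn : measurable (W n : set T) := open_measurable_Rn oW.
have FE : F `&` W n = F by apply/setIidl => x Fx; apply: FW; exact: subset_closure.
suff : mrestr a mWn F = mrestr b mWn F by rewrite /mrestr FE.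
have oI : setI_closed (@open 'rV[R]_N) by move=> X Y; exact: openI.
have oT : forall k : nat, @open 'rV[R]_N setT by move=> _; exact: openT.
have UT : \bigcup_(k : nat) [set: T] = [set: T].
  by apply/seteqP; split=> // x _; exists 0%N.
apply: (@measure_unique _ R T (@open 'rV[R]_N) (fun=> setT) erefl oI oT UT
  (mrestr a mWn) (mrestr b mWn)) => //.
- move=> X oX; rewrite /mrestr/=; apply: abo; first exact: openI.
  by move=> x [_ Wx]; rewrite -WV; exists n.
- by move=> _; have := afin _ mWn cW; rewrite -{1}(setTI (W n : set T)).
Qed.

End uniqueness.

(** * Lebesgue measure and densities *)

Section measure_packaging.
Context d d' (T : measurableType d) (T' : measurableType d') (R : realType).
Variable m : {measure set T -> \bar R}.

(** A copy of [m] indexed by a proof of sigma-finiteness, so that the structure required of the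
    second factor of a product measure can be attached to it. *)
Definition with_sigma_finite (_ : sigma_finite setT m) : set T -> \bar R := m.

HB.instance Definition _ (H : sigma_finite setT m) :=
  Measure.copy (with_sigma_finite H) m.
HB.instance Definition _ (H : sigma_finite setT m) :=
  @Measure_isSigmaFinite.Build _ _ _ (with_sigma_finite H) H.

Lemma image_measure (f : T -> T') : measurable_fun setT f ->
  exists s : {measure set T' -> \bar R}, forall A, s A = m (f @^-1` A).
Proof.
move=> mf; unshelve refine (ex_intro _
  (pushforward m f : {measure set _ -> \bar R}) _); [exact: mf|by []].
Qed.

End measure_packaging.

Section lebesgue_measure_Rn.
Context {R : realType}.
Local Open Scope ereal_scope.

Lemma open_rational_balls N (V : set 'rV[R]_N) : open V ->
  V = \bigcup_(p in [set p : 'rV[rat]_N * nat |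
        ball (map_mx ratr p.1 : 'rV[R]_N) p.2.+1%:R^-1 `<=` V])
      ball (map_mx ratr p.1 : 'rV[R]_N) p.2.+1%:R^-1.
Proof.
move=> oV; apply/seteqP; split=> [x Vx|x [p /= pV] /pV//].
have [q [k [qx qV]]] := rational_ball_subset oV Vx.
exists (q, k) => //=; apply: subset_trans qV; apply: le_ball.
by rewrite ler_peMl// ler1n.
Qed.

Definition row_cons N (p : R * 'rV[R]_N) : 'rV[R]_(1 + N) :=
  row_mx (\row_(_ < 1) p.1) p.2.

Lemma row_cons_ball N (c : 'rV[R]_(1 + N)) (r : R) : (0 < r)%R ->
  @row_cons N @^-1` (ball c r) =
  ball (lsubmx c 0%R 0%R) r `*` ball (rsubmx c) r.
Proof.
move=> r0; apply/seteqP; split=> [[t y]|[t y]] /=.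
  move=> /(mx_ballP _ _ r0) H; split.
    by have := H (lshift N 0%R : 'I_(1 + N)); rewrite /row_cons row_mxEl !mxE.
  apply/mx_ballP => // i; have := H (rshift 1 i : 'I_(1 + N)).
  by rewrite /row_cons row_mxEr mxE.
move=> [ct /(mx_ballP _ _ r0) cy]; apply/mx_ballP => // i.
have [j ->|j ->] := @split_ordP 1 N i.
  by rewrite /row_cons row_mxEl !mxE (ord1 j); move: ct; rewrite !mxE.
by have := cy j; rewrite /row_cons row_mxEr mxE.
Qed.

Local Notation T N := (Rn R N).

Lemma ball_measurable N (c : 'rV[R]_N) (r : R) : (0 < r)%R -> measurable (ball c r : set (T N)).
Proof. by move=> r0; apply: open_measurable_Rn; exact: ball_open. Qed.

(** Under [row_cons] a sup-norm ball pulls back to an interval times a ball, and every open set is a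
    countable union of rational balls. *)
Lemma measurable_row_cons N :
  measurable_fun [set: measurableTypeR R * T N] (@row_cons N : _ -> T (1 + N)).
Proof.
have E : @measurable _ (T (1 + N)) = <<s @open 'rV[R]_(1 + N) >> by [].
apply: (measurability _ E).
move=> _ [V oV <-]; rewrite setTI (open_rational_balls oV) preimage_bigcup.
rewrite bigcup_mkcond; apply: countable_bigcupT_measurable => // p.
case: ifPn => // _; rewrite row_cons_ball//; apply: measurableX.
  by apply: open_measurable; exact: ball_open.
by apply: ball_measurable.
Qed.

(** The invariant of the induction on the dimension: finiteness gives the sigma-finiteness needed to
    form the next product, and positivity makes the denominators of densities nonzero. *)
Definition positive_on_balls N (m : set (T N) -> \bar R) :=
  forall (c : 'rV[R]_N) (r : R), (0 < r)%R -> 0 < m (ball c r) < +oo.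

Lemma positive_on_balls_sigma_finite N (m : {measure set (T N) -> \bar R}) :
  positive_on_balls m -> sigma_finite setT m.
Proof.
move=> mb; exists (fun n => ball (0 : 'rV[R]_N)%R n.+1%:R); last first.
  move=> n; split; first by apply: ball_measurable.
  by have /andP[] := mb (0 : 'rV[R]_N)%R n.+1%:R (ltr0Sn _ _).
apply/esym/seteqP; split=> // x _.
have [n xn] : exists n, (`|x| < n.+1%:R)%R.
  by exists (Num.truncn `|x|); rewrite truncnS_gt.
by exists n => //; rewrite -ball_normE/= sub0r normrN.
Qed.

(** In the induction step the measure is the image under [row_cons] of the product of Lebesgue
    measure on the line with the measure in one dimension less; sections of Borel sets are the sets
    occurring in [lebesgueN]. *)
Lemma lebesgueN_measure N : exists m : {measure set (T N) -> \bar R},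
  (forall B : set (T N), measurable B -> lebesgueN B = m B) /\ positive_on_balls m.
Proof.
elim: N => [|N [m [mE mb]]].
  exists (@dirac _ (T 0) (0%R : 'rV[R]_0) R); split=> // c r r0.
  suff -> : ball c r = setT by rewrite /= /dirac indicE in_setT lte01 ltry.
  by apply/seteqP; split=> // x _; apply/mx_ballP => // -[].
pose s := with_sigma_finite (positive_on_balls_sigma_finite mb).
have [mu muE] := image_measure
  (@product_measure1 _ _ (measurableTypeR R) (T N) R (@lebesgue_measure R) s)
  (@measurable_row_cons N).
exists mu; split=> [B mB|c r r0].
  rewrite muE /= /product_measure1; apply: eq_integral => t _ /=.
  have mB' : measurable (@row_cons N @^-1` B : set (measurableTypeR R * T N)).
    by rewrite -[X in measurable X]setTI; exact: measurable_row_cons.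
  have -> : [set y : 'rV[R]_N | B (row_mx (\row_(_ < 1) t) y : 'rV[R]_(1 + N))] = xsection (@row_cons N @^-1` B) t.
    by apply/seteqP; split=> y; rewrite /xsection/= inE.
  by rewrite mE//; exact: (@measurable_xsection _ _ (measurableTypeR R) (T N)).
have -> : mu (ball c r) = @lebesgue_measure R (ball (lsubmx (c : 'rV_(1 + N)) 0%R 0%R) r) *
    m (ball (rsubmx (c : 'rV_(1 + N))) r).
  rewrite muE row_cons_ball//; apply: product_measure1E.
    by apply: open_measurable; exact: ball_open.
  exact: ball_measurable.
have /andP[m0 mfin] := mb (rsubmx (c : 'rV_(1 + N))) r r0.
rewrite lebesgue_measure_ball ?ltW// mule_gt0//=; last by rewrite lte_fin mulrn_wgt0.
by rewrite lte_mul_pinfty// lee_fin mulrn_wge0// ltW.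
Qed.

End lebesgue_measure_Rn.

Section euclidean_balls.
Context {R : realType} {N : nat}.
Local Notation T := (Rn R N).
Implicit Types (x y : 'rV[R]_N) (r s : R) (E F Omega : set T).

Lemma enorm_continuous x : continuous (fun y => enorm (y - x)).
Proof.
have cS : continuous (fun z : 'rV[R]_N => \sum_(i < N) (z - x) 0 i ^+ 2).
  apply: continuous_big => [|i _ y]; first exact: add_continuous.
  have E : (fun z : 'rV[R]_N => (z 0 i - x 0 i) * (z 0 i - x 0 i)) =
      (fun z : 'rV[R]_N => (z - x) 0 i ^+ 2).
    by apply/funext => z; rewrite !mxE expr2.
  have : {for y, continuous (fun z : 'rV[R]_N => (z 0 i - x 0 i) * (z 0 i - x 0 i))}.
    by apply: continuousM; apply: continuousB; [exact: coord_continuous|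
      exact: cst_continuous|exact: coord_continuous|exact: cst_continuous].
  by rewrite E.
by move=> y; apply: (@continuous_comp _ _ _ _ Num.sqrt); [exact: cS|exact: sqrt_continuous].
Qed.

Lemma eball_open x r : open (eball x r).
Proof.
have -> : eball x r = (fun y => enorm (y - x)) @^-1` [set t | t < r] by [].
have /continuousP := @enorm_continuous x; apply; exact: open_lt.
Qed.

Lemma eball_measurable x r : measurable (eball x r : set T).
Proof. by apply: open_measurable_Rn; exact: eball_open. Qed.

Lemma eball_center x r : 0 < r -> eball x r x.
Proof.
move=> r0; rewrite /eball/= subrr /enorm big1 ?sqrtr0// => i _.
by rewrite mxE expr0n.
Qed.

Lemma subset_eball x r s : r <= s -> eball x r `<=` eball x s.
Proof. by move=> rs y; rewrite /eball/= => /lt_le_trans; exact. Qed.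

Lemma eball_ball x r : 0 < r -> eball x r `<=` ball x r.
Proof.
move=> r0 y; rewrite /eball/= => yr; apply/mx_ballP => // i.
by rewrite distrC; apply: le_lt_trans yr; have := ler_enorm (y - x) i; rewrite !mxE.
Qed.

(** With [N.+1] instead of [N] the sum of the [N] coordinate bounds is strictly below [r], and the
    quotient makes sense for [N = 0]. *)
Lemma ball_eball x r : 0 < r -> ball x (r / N.+1%:R) `<=` eball x r.
Proof.
move=> r0 y; have s0 : 0 < r / N.+1%:R by rewrite divr_gt0.
move=> /(mx_ballP _ _ s0) H; rewrite /eball/=.
apply: (le_lt_trans (enorm_le_sum _)).
apply: (@le_lt_trans _ _ (\sum_(i < N) (r / N.+1%:R))).
  by apply: ler_sum => i _; rewrite !mxE distrC ltW.
rewrite sumr_const card_ord -[X in X < _]mulr_natr -mulrA gtr_pMr// mulrC.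
by rewrite ltr_pdivrMr// mul1r ltr_nat.
Qed.

Lemma open_eball (U : set 'rV[R]_N) x : open U -> U x -> exists2 r, 0 < r & eball x r `<=` U.
Proof.
move=> oU Ux; have /nbhs_ballP[e /= e0 eU] := open_nbhs_nbhs (conj oU Ux).
by exists e => //; apply: subset_trans eU; exact: eball_ball.
Qed.

Lemma le_lebesgueN E F : measurable E -> measurable F -> E `<=` F ->
  (lebesgueN E <= lebesgueN F)%E.
Proof.
by move=> mE mF EF; have [m [H _]] := @lebesgueN_measure R N;
  rewrite !H//; apply: le_measure; rewrite ?inE.
Qed.

Lemma lebesgueN_eball x r : 0 < r -> (0 < lebesgueN (eball x r) < +oo)%E.
Proof.
move=> r0; have [m [H mb]] := @lebesgueN_measure R N.
have s0 : 0 < r / N.+1%:R by rewrite divr_gt0.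
have meb := eball_measurable x r.
rewrite H//; apply/andP; split.
  have /andP[+ _] := mb x _ s0; move=> /lt_le_trans; apply.
  by apply: le_measure; rewrite ?inE//; [exact: ball_measurable|exact: ball_eball].
have /andP[_ +] := mb x _ r0; apply: le_lt_trans.
by apply: le_measure; rewrite ?inE//; [exact: ball_measurable|exact: eball_ball].
Qed.

Lemma lebesgueN_split E F x r : 0 < r -> measurable E -> measurable F ->
  eball x r `<=` E `|` F -> E `&` F = set0 ->
  [/\ lebesgueN (E `&` eball x r) \is a fin_num,
      lebesgueN (F `&` eball x r) \is a fin_num,
      (0 <= lebesgueN (E `&` eball x r))%E, (0 <= lebesgueN (F `&` eball x r))%E &
      lebesgueN (eball x r) =
        (lebesgueN (E `&` eball x r) + lebesgueN (F `&` eball x r))%E].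
Proof.
move=> r0 mE mF cEF EF0; have [m [H mb]] := @lebesgueN_measure R N.
have meb := eball_measurable x r.
have mEb : measurable (E `&` eball x r : set T) by exact: measurableI.
have mFb : measurable (F `&` eball x r : set T) by exact: measurableI.
have fin (G : set T) : measurable G -> G `<=` eball x r -> m G \is a fin_num.
  move=> mG Gb; rewrite ge0_fin_numE//; have /andP[_ +] := lebesgueN_eball x r0.
  by rewrite H//; apply: le_lt_trans; apply: le_measure; rewrite ?inE.
rewrite !H//; split=> //; [exact: fin|exact: fin|].
rewrite -measureU//; last by rewrite setIACA setIid EF0 set0I.
by congr (m _); rewrite -setIUl; apply/esym/setIidr.
Qed.

End euclidean_balls.

(** * Densities and precise representatives of indicators *)

Section densities.
Context {R : realType} {N : nat}.
Local Notation T := (Rn R N).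
Implicit Types (x y : 'rV[R]_N) (r s : R) (E F Omega : set T).

Lemma has_density_unique E x a b : has_density E x a -> has_density E x b -> a = b.
Proof. by move=> Ea Eb; exact: (cvg_unique _ Ea Eb). Qed.

Lemma has_density_null E x r : 0 < r -> measurable E -> lebesgueN (E `&` eball x r) = 0%E ->
  has_density E x 0.
Proof.
move=> r0 mE E0; apply: cvg_near_cst; near=> s.
have meb t := @eball_measurable R N x t.
suff -> : lebesgueN (E `&` eball x s) = 0%E by rewrite mul0r.
have sr : s <= r by near: s; exact: nbhs_right_le.
apply/eqP; rewrite eq_le; apply/andP; split.
  by rewrite -E0; apply: le_lebesgueN; [exact: measurableI..|apply: setIS; exact: subset_eball].
have [m [H _]] := @lebesgueN_measure R N.
by rewrite H//; exact: measurableI.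
Unshelve. all: by end_near. Qed.

(** Complementarity is asked for in a single ball only, so the lemma serves both for a set and its
    complement and, at points of an open [Omega], for [E] and its complement in [Omega]. *)
Lemma has_density_compl E F x r d : 0 < r -> measurable E -> measurable F ->
  eball x r `<=` E `|` F -> E `&` F = set0 ->
  has_density E x d -> has_density F x (1 - d).
Proof.
move=> r0 mE mF cEF EF0 Ed; rewrite /has_density.
have : 1 - fine (lebesgueN (E `&` eball x s)) / fine (lebesgueN (eball x s))
    @[s --> 0^'+] --> 1 - d by apply: cvgB => //; exact: cvg_cst.
apply: cvg_trans; apply: near_eq_cvg; near=> s.
have s0 : 0 < s by near: s; exact: nbhs_right_gt.
have sr : s <= r by near: s; exact: nbhs_right_le.
have cs : eball x s `<=` E `|` F := subset_trans (subset_eball sr) cEF.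
have [e f _ _ ->] := lebesgueN_split s0 mE mF cs EF0.
have /andP[] := lebesgueN_eball x s0.
have [_ _ _ _ ->] := lebesgueN_split s0 mE mF cs EF0.
move: e f; move: (lebesgueN _) (lebesgueN _) => [a||] [b||]// _ _ /=; rewrite lte_fin => ab0 _.
by field; rewrite gt_eqF.
Unshelve. all: by end_near. Qed.

Lemma density_setC E x a : measurable E -> has_density (~` E) x a -> has_density E x (1 - a).
Proof.
move=> mE; apply: (has_density_compl (ltr01 : 0 < 1 :> R)) => //; first exact: measurableC.
  by rewrite setUC setUv.
by rewrite setIC setICr.
Qed.

Lemma has_density_full E x r : 0 < r -> measurable E -> eball x r `<=` E ->
  has_density E x 1.
Proof.
move=> r0 mE bE; rewrite -[X in has_density _ _ X]subr0.
apply: (@has_density_compl set0 E x r) => //; first by rewrite set0U.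
  by rewrite set0I.
apply: (@has_density_null _ _ r) => //; rewrite set0I.
by have [m [H _]] := @lebesgueN_measure R N; rewrite H.
Qed.

Lemma has_density_set0 x : has_density (set0 : set T) x 0.
Proof.
apply: (@has_density_null _ _ 1) => //; rewrite set0I.
by have [m [H _]] := @lebesgueN_measure R N; rewrite H.
Qed.

End densities.

Section representatives.
Context {R : realType} {N : nat}.
Local Notation T := (Rn R N).
Variables (Omega E : set T).
Hypotheses (oOmega : open (Omega : set 'rV[R]_N)) (mE : measurable E).
Hypothesis EO : E `<=` Omega.

Let mO : measurable Omega. Proof. exact: open_measurable_Rn. Qed.

Lemma has_density_Omega x : Omega x -> has_density Omega x 1.
Proof.
by move=> /(open_eball oOmega)[r r0 rO]; exact: has_density_full r0 mO rO.
Qed.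

Lemma has_density_diff x a : Omega x ->
  has_density E x a <-> has_density (Omega `\` E) x (1 - a).
Proof.
move=> /(open_eball oOmega)[r r0 rO].
have mOE : measurable (Omega `\` E) by exact: measurableD.
have c1 : eball x r `<=` E `|` Omega `\` E.
  by rewrite setDUK.
split; first by apply: has_density_compl c1 _ => //; rewrite setDIK.
rewrite -[X in _ -> has_density _ _ X](subKr 1 a).
by apply: (has_density_compl r0) => //; rewrite 1?setUC// setIC setDIK.
Qed.

(** The set where the indicator is below [t] is empty for [t <= 0], the rest of [Omega] after
    removing [E] for [0 < t <= 1], and [Omega] for [1 < t]. The last has density 1 at [x], so the
    supremum is 1 or 0 depending only on the middle range. *)
Lemma lower_rep_indic x : Omega x ->
  lower_rep Omega (\1_E : T -> R) x = (\1_(density1 E) x)%:E.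
Proof.
move=> Ox; rewrite /lower_rep; set S := [set t | _].
have S_le0 t : (t <= 0)%E -> S t.
  move=> t0; rewrite /S/= (_ : [set _ | _] = set0); first exact: has_density_set0.
  apply/seteqP; split=> // y [_]; rewrite ltNge => /negP; apply.
  by rewrite (le_trans t0)// lee_fin.
have S_gt1 t : (1 < t)%E -> ~ S t.
  move=> t1; rewrite /S/= (_ : [set _ | _] = Omega).
    by move=> /(has_density_unique (has_density_Omega Ox))/eqP; rewrite oner_eq0.
  apply/seteqP; split=> [y []//|y Oy]; split=> //.
  by apply: le_lt_trans t1; rewrite lee_fin indicE; case: (_ \in _).
have S_mid t : (0 < t)%E -> (t <= 1)%E -> S t <-> has_density E x 1.
  move=> t0 t1; rewrite has_density_diff// subrr /S/=.
  rewrite (_ : [set _ | _] = Omega `\` E)//.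
  apply/seteqP; split=> y [Oy H]; split=> //.
    move=> Ey; move: H; rewrite indicE mem_set// => /(le_lt_trans t1).
    by rewrite ltxx.
  by rewrite indicE memNset.
rewrite indicE; have [dE|ndE] := pselect (density1 E x).
  rewrite mem_set//; apply/eqP; rewrite eq_le; apply/andP; split.
    by apply: ge_ereal_sup => t St; rewrite leNgt; apply/negP => /S_gt1.
  by apply: ereal_sup_ubound; apply/S_mid.
rewrite memNset//; apply/eqP; rewrite eq_le; apply/andP; split.
  apply: ge_ereal_sup => t St; rewrite leNgt; apply/negP => t0; apply: ndE.
  apply/(S_mid t) => //; rewrite leNgt; apply/negP => /S_gt1; exact.
by apply: ereal_sup_ubound; exact: S_le0.
Qed.

(** The set where the indicator exceeds [t] is [Omega] for [t < 0], [E] for [0 <= t < 1] and empty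
    for [1 <= t]. The infimum is thus 0 exactly where [E] has density 0, that is where its
    complement has density 1. *)
Lemma upper_rep_indic x : Omega x ->
  upper_rep Omega (\1_E : T -> R) x = (\1_(density1 E `|` ess_boundary E) x)%:E.
Proof.
move=> Ox; rewrite /upper_rep; set S := [set t | _].
have S_lt0 t : (t < 0)%E -> ~ S t.
  move=> t0; rewrite /S/= (_ : [set _ | _] = Omega).
    by move=> /(has_density_unique (has_density_Omega Ox))/eqP; rewrite oner_eq0.
  apply/seteqP; split=> [y []//|y Oy]; split=> //.
  by apply: lt_le_trans t0 _; rewrite lee_fin.
have S_ge1 t : (1 <= t)%E -> S t.
  move=> t1; rewrite /S/= (_ : [set _ | _] = set0); first exact: has_density_set0.
  apply/seteqP; split=> // y [_]; rewrite ltNge => /negP; apply.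
  by apply: le_trans t1; rewrite lee_fin indicE; case: (_ \in _).
have S_mid t : (0 <= t)%E -> (t < 1)%E -> S t <-> has_density E x 0.
  move=> t0 t1; rewrite /S/= (_ : [set _ | _] = E)//.
  apply/seteqP; split=> y => [[Oy]|Ey].
    rewrite indicE; have [Ey//|nEy] := pselect (E y).
    by rewrite memNset// ltNge t0.
  by split; [exact: EO|rewrite indicE mem_set].
have cE : density1 (~` E) x <-> has_density E x 0.
  rewrite /density1/=; split=> H; first by rewrite -(subrr 1); exact: density_setC.
  by rewrite -(subr0 1); apply: density_setC; rewrite ?setCK//; exact: measurableC.
rewrite indicE; have [dE|ndE] := pselect (has_density E x 0).
  rewrite memNset; last first.
    move=> [/(has_density_unique dE)/eqP|]; first by rewrite eq_sym oner_eq0.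
    by apply; right; apply/cE.
  apply/eqP; rewrite eq_le; apply/andP; split.
    by apply: ereal_inf_lbound; apply/S_mid.
  by apply: le_ereal_inf_tmp => t St; rewrite leNgt; apply/negP => /S_lt0.
rewrite mem_set; last first.
  by have [|nd] := pselect (density1 E x); [left|right=> -[//|/cE]].
apply/eqP; rewrite eq_le; apply/andP; split.
  by apply: ereal_inf_lbound; exact: S_ge1.
apply: le_ereal_inf_tmp => t St; rewrite leNgt; apply/negP => t1; apply: ndE.
apply/(S_mid t) => //; rewrite leNgt; apply/negP => /S_lt0; exact.
Qed.

End representatives.

(** * The boundary as the complement of two open sets *)

Section null_neighborhoods.
Context {R : realType} {N : nat}.
Local Notation T := (Rn R N).
Implicit Types (E F : set T) (x : 'rV[R]_N).

Definition null_near F : set T :=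
  [set x | exists2 r : R, 0 < r & lebesgueN (F `&` eball x r) = 0%E].

Lemma open_null_near F : measurable F -> open (null_near F : set 'rV[R]_N).
Proof.
move=> mF; rewrite openE => x [r r0 Fr].
suff sub : eball x r `<=` null_near F.
  apply: (filterS sub); apply: open_nbhs_nbhs; split; [exact: eball_open|exact: eball_center].
move=> y /(open_eball (@eball_open _ _ x r))[s s0 sr]; exists s => //.
have mFs t z : measurable (F `&` (eball z t : set T)).
  by apply: measurableI => //; exact: eball_measurable.
apply/eqP; rewrite eq_le; apply/andP; split.
  by rewrite -Fr; apply: le_lebesgueN => //; apply: setIS.
by have [m [H _]] := @lebesgueN_measure R N; rewrite H.
Qed.

(** The measure of a ball is the sum of the measures of its parts in [E] and outside [E], so failure
    of the second strict inequality means that the part outside [E] is null. *)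
Lemma setC_minus_boundary E : measurable E ->
  ~` minus_boundary E = null_near E `|` null_near (~` E).
Proof.
move=> mE; have mCE : measurable (~` E) by exact: measurableC.
have split x r : 0 < r -> [/\ (0 <= lebesgueN (E `&` eball x r))%E &
    (lebesgueN (E `&` eball x r) < lebesgueN (eball x r))%E <->
    lebesgueN (~` E `&` eball x r) <> 0%E].
  move=> r0; have [||e f e0 f0 ->] := @lebesgueN_split R N E (~` E) x r r0 mE mCE.
  - by rewrite setUv.
  - by rewrite setICr.
  split=> //; rewrite -[X in (X < _)%E]adde0 lteD2lE// lt_neqAle f0 andbT eq_sym.
  by split=> [/eqP|/eqP].
apply/seteqP; split=> [x|x [[r r0 E0]|[r r0 E0]] bE]; last 2 first.
- by have [] := bE r r0; rewrite E0 ltxx.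
- by have [_] := split x r r0; have [_ + [+ _]] := bE r r0; move=> h /(_ h).
rewrite /minus_boundary/= -existsNE => -[r /not_implyP[r0]].
have [e0 lt] := split x r r0.
have [E0|E0] := pselect (lebesgueN (E `&` eball x r) = 0%E).
  by move=> _; left; exists r.
have [F0|F0] := pselect (lebesgueN (~` E `&` eball x r) = 0%E).
  by move=> _; right; exists r.
case; split; last exact/lt.
by rewrite lt_neqAle e0 andbT eq_sym; exact/eqP.
Qed.

Lemma null_near_density0 E x : measurable E -> null_near E x -> has_density E x 0.
Proof. by move=> mE [r r0 E0]; exact: has_density_null E0. Qed.

Lemma null_near_closure E x : measurable E -> null_near E x ->
  ~ (density1 E `|` ess_boundary E) x.
Proof.
move=> mE nE; have E0 := null_near_density0 mE nE; case.
  by move=> /(has_density_unique E0)/eqP; rewrite eq_sym oner_eq0.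
apply; right; rewrite /density1/= -[X in has_density _ _ X]subr0.
by apply: density_setC; [exact: measurableC|rewrite setCK].
Qed.

Lemma null_nearC_density1 E x : measurable E -> null_near (~` E) x -> density1 E x.
Proof.
move=> mE /(null_near_density0 (measurableC mE)) H.
by rewrite /density1/= -[X in has_density _ _ X]subr0; exact: density_setC.
Qed.

End null_neighborhoods.

(** * The divergence of the weighted field *)

Section test_function_lemmas.
Context {R : realType} {N : nat}.
Local Notation T := (Rn R N).
Implicit Types (U V : set 'rV[R]_N) (phi : 'rV[R]_N -> R).

Lemma pderiv_locally_constant phi (c : R) x i : (\forall y \near x, phi y = c) ->
  pderiv i phi x = 0.
Proof.
move=> phic; rewrite /pderiv (@near_eq_derive _ _ _ phi (cst c))//.
exact: derive_cst.
Qed.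

Lemma pderiv_open_constant phi U (c : R) x i : open U -> (forall y, U y -> phi y = c) ->
  U x -> pderiv i phi x = 0.
Proof.
move=> oU phic Ux; apply: (@pderiv_locally_constant _ c).
by have := open_nbhs_nbhs (conj oU Ux); apply: filterS.
Qed.

Lemma test_function_pderiv V phi i : test_function V phi -> test_function V (pderiv i phi).
Proof.
move=> [sphi cphi]; split.
  by move=> s; have := sphi (rcons s i); rewrite /iter_pderiv foldr_rcons.
have sub : [set x | pderiv i phi x != 0] `<=` closure [set x | phi x != 0].
  move=> x; apply: contraPP => nx; apply/negP; rewrite negbK; apply/eqP.
  apply: (@pderiv_open_constant _ (~` closure [set x | phi x != 0]) 0) => //.
    by apply: closed_openC; exact: closed_closure.
  move=> y ny; apply/eqP; rewrite -[_ == _]negbK; apply/negP => phiy.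
  by apply: ny; exact: subset_closure.
have [bphi sV] := cphi; have cl : closure [set x | pderiv i phi x != 0] `<=`
    closure [set x | phi x != 0].
  apply: subset_trans (closure_subset sub) _.
  by rewrite closureE => x; apply; split=> //; exact: closed_closure.
split; last exact: subset_trans sV.
by have [M [Mr HM]] := bphi; exists M; split=> // M' MM' x /cl; exact: HM.
Qed.

Lemma test_function_bounded V phi : test_function V phi ->
  exists C : R, forall x, `|phi x| <= C.
Proof.
move=> tphi; have [_ cphi] := tphi.
have /(@continuous_compact _ _ phi) := relcompact_compact cphi.
have cont : {within closure [set x | phi x != 0], continuous phi}.
  by apply: continuous_subspaceT; exact: test_function_continuous tphi.
move=> /(_ cont)/compact_bounded[M [_ HM]].
exists (Num.max (M + 1) 0) => x; have [->|phix] := eqVneq (phi x) 0.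
  by rewrite normr0 le_max lexx orbT.
rewrite le_max; apply/orP; left; apply: (HM (M + 1)); first by rewrite ltrDl.
by exists x => //; exact: subset_closure.
Qed.

Lemma measurable_test_function V phi (D : set T) : measurable D -> test_function V phi ->
  measurable_fun D (EFin \o phi : T -> \bar R).
Proof.
move=> mD tphi; apply/measurable_EFinP; apply: continuous_measurable_Rn => //.
exact: test_function_continuous tphi.
Qed.

Local Open Scope ereal_scope.

Lemma test_function_ebounded V phi : test_function V phi ->
  exists C : R, forall x, `|(phi x)%:E| <= C%:E.
Proof.
by move=> /test_function_bounded[C HC]; exists C => x; rewrite lee_fin.
Qed.

(** [m] may have infinite mass on [V], but [phi] is bounded and vanishes off a set that is
    relatively compact in [V], where [m] is finite. *)
Lemma test_function_integrable (V : set T) phi (m : {measure set T -> \bar R}) :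
  open (V : set 'rV[R]_N) -> (forall F : set T, measurable F -> relcompact F V -> m F < +oo) ->
  test_function V phi -> m.-integrable V (EFin \o phi).
Proof.
move=> oV mfin tphi; have mV : measurable V := open_measurable_Rn oV.
pose S : set T := [set x | (phi x != 0)%R].
have mS : measurable S.
  have /(_ measurableT [set t | (t != 0)%R]) := continuous_measurable_Rn
    (@measurableT _ T) (test_function_continuous tphi).
  by rewrite setTI; apply; rewrite -[X in measurable X]setCK; apply: measurableC;
    rewrite (_ : ~` _ = [set 0%R])//; apply/seteqP; split=> t /=; [move/negP; rewrite negbK => /eqP|
    move=> ->; rewrite eqxx].
have SV : S `<=` V by move=> x Sx; apply: tphi.2.2; exact: subset_closure.
have iS : m.-integrable S (EFin \o phi).
  have [C HC] := test_function_ebounded tphi.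
  apply: (@bounded_integrable _ _ _ m S (EFin \o phi) C) => //.
    by apply: mfin => //; case: tphi.
    exact: measurable_test_function tphi.
  by move=> x _; exact: HC.
pose psi : T -> \bar R := EFin \o phi.
have psiE : psi = psi \_ S.
  apply/funext => x; rewrite /patch; case: ifPn => // /negP nS.
  congr EFin; apply/eqP; rewrite -[_ == _]negbK; apply/negP => phix.
  by apply: nS; rewrite inE.
suff : m.-integrable V psi by [].
rewrite psiE; apply: (integrable_restrict _ _ _ _).1 => //.
by rewrite (setIidr SV).
Qed.

End test_function_lemmas.

Section signed_integral_algebra.
Context {R : realType} {N : nat}.
Local Notation T := (Rn R N).
Variables (Omega : set T) (oOmega : open (Omega : set 'rV[R]_N)).
Implicit Types (B F : set T) (mu nu : set T -> \bar R) (f g w : T -> \bar R).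
Local Open Scope ereal_scope.

Let mOmega : measurable Omega. Proof. exact: open_measurable_Rn. Qed.

Lemma signed_integral0 mu D : radon_loc Omega mu ->
  signed_integral Omega mu D (cst 0) = 0.
Proof.
move=> rmu; have [mp [mn [Hv _]]] := jordan_loc oOmega rmu.
have -> : signed_integral Omega mu D (cst 0) = integral mp D (cst 0) - integral mn D (cst 0).
  by congr (_ - _); apply: eq_integral_set_function => B mB; case: (Hv B mB).
by rewrite !integral0 sube0.
Qed.

Lemma signed_integral_fin_num mu g (C : R) : radon_fin Omega mu ->
  measurable_fun Omega g -> (forall x, Omega x -> `|g x| <= C%:E) ->
  signed_integral Omega mu Omega g \is a fin_num.
Proof.
move=> /(radon_fin_difference oOmega)[m1 [m2 H]] mg gC.
rewrite (difference_signed_integral oOmega H mg gC); have [h1 h2 _] := H.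
by rewrite fin_numB !integrable_fin_num//; exact: bounded_integrable gC.
Qed.

Lemma signed_integralD mu nu g (C : R) : radon_fin Omega mu -> radon_fin Omega nu ->
  measurable_fun Omega g -> (forall x, Omega x -> `|g x| <= C%:E) ->
  signed_integral Omega (fun B => mu B + nu B) Omega g =
  signed_integral Omega mu Omega g + signed_integral Omega nu Omega g.
Proof.
move=> /(radon_fin_difference oOmega)[m1 [m2 H]] /(radon_fin_difference oOmega)[n1 [n2 K]] mg gC.
rewrite (difference_signed_integral oOmega H mg gC).
rewrite (difference_signed_integral oOmega K mg gC).
rewrite (difference_signed_integral oOmega (differenceD oOmega H K) mg gC).
have [h1 h2 _] := H; have [k1 k2 _] := K.
have i (m : {measure set T -> \bar R}) : m Omega < +oo -> m.-integrable Omega g.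
  by move=> mf; exact: bounded_integrable gC.
rewrite !integral_measure_add//; try exact: i.
have := integrable_fin_num mOmega (i _ h1); have := integrable_fin_num mOmega (i _ h2).
have := integrable_fin_num mOmega (i _ k1); have := integrable_fin_num mOmega (i _ k2).
move: (integral n2 _ _) (integral n1 _ _) (integral m2 _ _) (integral m1 _ _).
move=> [a||] [b||] [c||] [e||]// _ _ _ _; congr EFin; ring.
Qed.

Lemma radon_finD mu nu : radon_fin Omega mu -> radon_fin Omega nu ->
  radon_fin Omega (fun B => mu B + nu B).
Proof.
move=> /(radon_fin_difference oOmega)[m1 [m2 H]] /(radon_fin_difference oOmega)[n1 [n2 K]].
exact: (difference_radon_fin oOmega (differenceD oOmega H K)).
Qed.

Lemma density_radon_fin k (A : 'I_k -> set T -> \bar R) i w :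
  (forall j, radon_loc Omega (A j)) -> (vector_variation Omega A).-integrable Omega w ->
  radon_fin Omega (density_measure Omega w (A i)).
Proof.
move=> rA iw; have [m1 [m2 [H _]]] := weighted_difference oOmega i rA iw.
exact: difference_radon_fin H.
Qed.

Lemma density_signed_integral k (A : 'I_k -> set T -> \bar R) i w g (C : R) :
  (forall j, radon_loc Omega (A j)) -> (vector_variation Omega A).-integrable Omega w ->
  measurable_fun Omega g -> (forall x, Omega x -> `|g x| <= C%:E) ->
  signed_integral Omega (density_measure Omega w (A i)) Omega g =
  signed_integral Omega (A i) Omega (fun x => w x * g x).
Proof.
move=> rA iw mg gC; have [m1 [m2 [H HI]]] := weighted_difference oOmega i rA iw.
by rewrite (HI g C)//; exact: difference_signed_integral gC.
Qed.

(** With the negative parts moved across, [mp + nn] and [mn + np] are measures with equal test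
    integrals, and [measure_test_unique] applies to them although [mu] and [nu] may have infinite
    variation on [Omega]. *)
Lemma radon_unique mu nu : radon_loc Omega mu -> radon_loc Omega nu ->
  (forall phi, test_function Omega phi ->
    signed_integral Omega mu Omega (EFin \o phi) =
    signed_integral Omega nu Omega (EFin \o phi)) ->
  forall F, measurable F -> relcompact F Omega -> mu F = nu F.
Proof.
move=> rmu rnu H F mF cF.
have [mp [mn [muv muf]]] := jordan_loc oOmega rmu.
have [np [nn [nuv nuf]]] := jordan_loc oOmega rnu.
have sE (l : set T -> \bar R) (lp ln : {measure set T -> \bar R}) f :
    (forall B, measurable B -> upper_variation Omega l B = lp B /\
      lower_variation Omega l B = ln B) ->
    signed_integral Omega l Omega f = \int[lp]_(x in Omega) f x - \int[ln]_(x in Omega) f x.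
  move=> lv; rewrite /signed_integral; congr (_ - _); apply: eq_integral_set_function => B mB;
    by case: (lv B mB).
have E : (measure_add mp nn : {measure set T -> \bar R}) F =
         (measure_add mn np : {measure set T -> \bar R}) F.
  apply: (@measure_test_unique _ _ Omega) => //; last exact: relcompact_subset.
    move=> G mG cG; have [? ? _] := muf G mG cG; have [? ? _] := nuf G mG cG.
    by rewrite packed_measure_addE lte_add_pinfty.
  move=> phi tphi _.
  have i (m : {measure set T -> \bar R}) : (forall G : set T, measurable G -> relcompact G Omega -> m G < +oo) ->
      m.-integrable Omega (EFin \o phi).
    by move=> mf; exact: test_function_integrable.
  have ip : mp.-integrable Omega (EFin \o phi) by apply: i => G mG cG; case: (muf G mG cG).
  have in_ : mn.-integrable Omega (EFin \o phi) by apply: i => G mG cG; case: (muf G mG cG).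
  have jp : np.-integrable Omega (EFin \o phi) by apply: i => G mG cG; case: (nuf G mG cG).
  have jn : nn.-integrable Omega (EFin \o phi) by apply: i => G mG cG; case: (nuf G mG cG).
  rewrite (integral_measure_add mOmega ip jn) (integral_measure_add mOmega in_ jp).
  apply: (fin_num_addB_eq (integrable_fin_num mOmega ip) (integrable_fin_num mOmega in_)
    (integrable_fin_num mOmega jp) (integrable_fin_num mOmega jn)).2.
  by rewrite -(sE _ _ _ _ muv) -(sE _ _ _ _ nuv) H.
move: E; rewrite !packed_measure_addE.
have [h1 h2 ->] := muf F mF cF; have [k1 k2 ->] := nuf F mF cF => E; apply/esym.
by apply: (fin_num_addB_eq _ _ _ _).1 E; rewrite ge0_fin_numE.
Qed.

End signed_integral_algebra.

Section finite_sum_of_measures.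
Context d (T : measurableType d) (R : realType).
Local Open Scope ereal_scope.

Lemma finite_sum_measure k (m : 'I_k -> {measure set T -> \bar R}) :
  exists s : {measure set T -> \bar R}, (forall B, s B = \sum_i m i B) /\
    forall D f, measurable D -> (forall i, (m i).-integrable D f) ->
      \int[s]_(x in D) `|f x| < +oo.
Proof.
elim: k m => [|k IH] m.
  exists mzero; split=> [B|D f mD _]; first by rewrite big_ord0.
  by rewrite integral_measure_zero ltry.
have [s [sE sI]] := IH (fun i => m (lift ord0 i)).
exists (measure_add (m ord0) s); split=> [B|D f mD mf].
  by rewrite packed_measure_addE sE big_ord_recl.
have /integrableP[mesf fi] := mf ord0.
rewrite ge0_integral_measure_add//; last exact: measurableT_comp.
by rewrite lte_add_pinfty// sI.
Qed.

Lemma integral_gt0_null (m : {measure set T -> \bar R}) D f : measurable D ->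
  measurable_fun D f -> (forall x, D x -> 0 < f x) -> \int[m]_(x in D) f x = 0 -> m D = 0.
Proof.
move=> mD mf f0 If.
have : ae_eq m D f (cst 0).
  apply/(ae_eq_integral_abs m mD mf); rewrite -If; apply: eq_integral => x /[!inE] Dx.
  by rewrite gee0_abs// ltW// f0.
move=> [B [mB B0 DB]]; apply/eqP; rewrite eq_le measure_ge0 andbT -B0.
apply: le_measure; rewrite ?inE// => x Dx; apply: DB => /= /(_ Dx).
by move: (f0 x Dx) => /[swap] ->; rewrite ltxx.
Qed.

End finite_sum_of_measures.

(** * Vanishing of a density off the support of its measure *)

Section support.
Context {R : realType} {N k : nat}.
Local Notation T := (Rn R N).
Variables (Omega : set T) (oOmega : open (Omega : set 'rV[R]_N)).
Variables (A : 'I_k -> set T -> \bar R) (rA : forall i, radon_loc Omega (A i)).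
Variables (w f : T -> \bar R).
Local Open Scope ereal_scope.
Hypothesis iw : (vector_variation Omega A).-integrable Omega w.
Hypothesis mf : measurable_fun Omega f.
Hypothesis fw : forall x, Omega x -> `|f x| <= `|w x|.

Let mOmega : measurable Omega. Proof. exact: open_measurable_Rn. Qed.

Let uv := upper_variation Omega (vector_variation Omega A).

Lemma integrable_le_vector (m : {measure set T -> \bar R}) :
  (forall B, measurable B -> m B <= vector_variation Omega A B) -> m.-integrable Omega f.
Proof.
move=> mv; have im : m.-integrable Omega w.
  exact: (integrable_le_set_function (vector_variation_set0 oOmega rA) mv iw).
exact: (le_integrable mOmega mf fw im).
Qed.

(* The total variation of A is never shown to be a measure: it is enough to
   squeeze it between the variations of the components and their sum. *)
Lemma upper_vector_variation_dominated : exists s : {measure set T -> \bar R},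
  (forall B, measurable B -> uv B <= s B) /\ \int[s]_(x in Omega) `|f x| < +oo.
Proof.
have /choice[mp /choice[mn H]] := fun i => jordan_loc oOmega (rA i).
have [s1 [s1E s1I]] := finite_sum_measure mp.
have [s2 [s2E s2I]] := finite_sum_measure mn.
exists (measure_add s1 s2); split.
  move=> B mB; apply: upper_vector_variation_le => // F mF cF.
  rewrite packed_measure_addE s1E s2E -big_split/=; apply: lee_sum => i _.
  have [_ /(_ F mF cF)[pf nf ->]] := H i.
  by rewrite (le_trans (lee_abs_sub _ _))// !gee0_abs.
have mabs : measurable_fun Omega (fun x => `|f x|) by exact: measurableT_comp.
rewrite ge0_integral_measure_add// lte_add_pinfty//.
  apply: s1I => // i; apply: integrable_le_vector => B mB.
  by have [/(_ B mB)[<- _] _] := H i; exact: upper_variation_le_vector.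
apply: s2I => // i; apply: integrable_le_vector => B mB.
by have [/(_ B mB)[_ <-] _] := H i; exact: lower_variation_le_vector.
Qed.

Lemma upper_vector_variation_ge0 B : 0 <= uv B.
Proof.
apply: ereal_sup_ubound; exists set0; last exact: vector_variation_set0.
by split=> //; exact: relcompact0.
Qed.

Lemma upper_vector_variation_set0 : uv set0 = 0.
Proof.
have [s [su _]] := upper_vector_variation_dominated.
apply/eqP; rewrite eq_le upper_vector_variation_ge0 andbT.
by rewrite -(measure0 s) su.
Qed.

Let nu := density_measure Omega f (vector_variation Omega A).

Lemma density_vector_variationE F : measurable F -> F `<=` Omega -> nu F = integral uv F f.
Proof.
move=> mF FO; rewrite /nu /density_measure (setIidl FO) /signed_integral.
rewrite (@eq_integral_set_function _ _ _ (lower_variation _ _) mzero); last first.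
  by move=> B mB; rewrite lower_vector_variation0.
by rewrite integral_measure_zero sube0.
Qed.

(* The variation only sees [fine], which sends infinite values to [0]; finiteness
   of the integral excludes them. *)
Lemma null_of_fine_integral (m : {measure set T -> \bar R}) F h :
  (forall B, measurable B -> m B <= uv B) -> measurable F -> F `<=` Omega ->
  measurable_fun F h -> (forall x, F x -> 0 < h x) -> (forall x, F x -> h x <= `|f x|) ->
  fine (integral uv F h) = 0%R -> m F = 0.
Proof.
move=> mu mF FO mh h0 hf I0.
have h0' x : F x -> 0 <= h x by move=> /h0/ltW.
have [s [su sI]] := upper_vector_variation_dominated.
have uv0 := upper_vector_variation_set0.
have uvI : integral uv F h = 0.
  have le_s : integral uv F h <= \int[s]_(x in F) h x.
    exact: ge0_le_integral_set_function.
  have fin : integral uv F h \is a fin_num.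
    rewrite ge0_fin_numE.
      apply: (le_lt_trans le_s); apply: le_lt_trans sI.
      apply: (@le_trans _ _ (\int[s]_(x in F) `|f x|)).
        apply: ge0_le_integral => //.
        by apply: measurableT_comp => //; exact: measurable_funS mf.
      apply: ge0_subset_integral => //.
      by apply: measurableT_comp.
    apply: le_trans (@ge0_le_integral_set_function _ _ _ mzero _ _ _ _ uv0 _ h0') => //.
      by rewrite integral_measure_zero.
    by move=> B mB; exact: upper_vector_variation_ge0.
  by rewrite -(fineK fin) I0.
apply: (@integral_gt0_null _ _ _ m F h) => //.
apply/eqP; rewrite eq_le integral_ge0// andbT -uvI.
by apply: ge0_le_integral_set_function.
Qed.

(** Where [f] is positive, and likewise where it is negative, the integral has no cancellation, so
    its vanishing forces the set to be null. *)
Lemma null_of_density_null (m : {measure set T -> \bar R}) F :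
  (forall B, measurable B -> m B <= uv B) -> measurable F -> F `<=` Omega ->
  (forall G, measurable G -> G `<=` F -> fine (nu G) = 0%R) ->
  m (F `&` [set x | f x != 0]) = 0.
Proof.
move=> mu mF FO nuF.
have mfF : measurable_fun F f by exact: measurable_funS mf.
pose P := F `&` [set x | 0 < f x]; pose M := F `&` [set x | f x < 0].
have mP : measurable P by exact: emeasurable_fun_o_infty.
have mM : measurable M by exact: emeasurable_fun_infty_o.
have mP0 : m P = 0.
  apply: (@null_of_fine_integral m P f mu mP) => //.
  - by move=> x [/FO].
  - by apply: measurable_funS mfF => // x [].
  - by move=> x [].
  - by move=> x _; exact: lee_abs.
  rewrite -density_vector_variationE//; last by move=> x [/FO].
  by apply: nuF => // x [].
have mM0 : m M = 0.
  have h0 x : M x -> 0 <= - f x by move=> [_ /= fx]; rewrite oppe_ge0 ltW.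
  apply: (@null_of_fine_integral m M (fun x => - f x) mu mM) => //.
  - by move=> x [/FO].
  - by apply: measurableT_comp => //; apply: measurable_funS mfF => // x [].
  - by move=> x [_ /=]; rewrite oppe_gt0.
  - by move=> x _; rewrite -abseN; exact: lee_abs.
  have E : integral uv M f = - integral uv M (fun x => - f x).
    rewrite -(ge0_integralN_set_function upper_vector_variation_set0 h0).
    by have -> : (fun x => - - f x) = f by apply/funext => x; rewrite oppeK.
  rewrite -[fine _]opprK -fineN -E -density_vector_variationE//; last by move=> x [/FO].
  by rewrite nuF ?oppr0// => x [].
have -> : F `&` [set x | f x != 0] = P `|` M.
  apply/seteqP; split=> [x [Fx /=]|x [[Fx /= fx]|[Fx /= fx]]].
  - by rewrite neq_lt => /orP[fx|fx]; [right|left].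
  - by split=> //=; rewrite gt_eqF.
  - by split=> //=; rewrite lt_eqF.
exact: etrans (measureU0 mP mM mM0) mP0.
Qed.

(** Each point off the support has an open neighbourhood of zero variation. Rational balls inside
    such neighbourhoods form a countable cover, and [f] vanishes almost everywhere on each of
    them. *)
Lemma support_complement_null (m : {measure set T -> \bar R}) :
  (forall B, measurable B -> m B <= uv B) ->
  m.-negligible ((Omega `\` measure_support Omega nu) `&` [set x | f x != 0]).
Proof.
move=> mu; pose Z := [set x | f x != 0].
(* The tripled ball is required to lie in [U] so that the ball itself is relatively compact in
   [Omega]; the lower bounds on the variation hold only for relatively compact sets. *)
pose good (p : 'rV[rat]_N * nat) := exists U : set 'rV[R]_N,
  [/\ U `<=` Omega, open U, signed_variation Omega nu U <= 0 &
      ball (map_mx ratr p.1 : 'rV[R]_N) (3 * p.2.+1%:R^-1) `<=` U].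
pose C (p : 'rV[rat]_N * nat) : set T := ball (map_mx ratr p.1 : 'rV[R]_N) p.2.+1%:R^-1.
pose E n := if unpickle n is Some p then
  (if `[< good p >] then C p `&` Z else set0) else set0.
have mC p : measurable (C p) by exact: ball_measurable.
have good_null p : good p -> m (C p `&` Z) = 0.
  move=> [U [UO oU U0 CU]].
  have r0 : (0 < p.2.+1%:R^-1 :> R)%R by rewrite invr_gt0.
  have CsU : C p `<=` U.
    by apply: subset_trans CU; apply: le_ball; rewrite ler_peMl ?ler1n// ltW.
  have cC : relcompact (C p) Omega.
    apply: relcompact_ball (subset_trans CU UO).
    by rewrite ltr_pMl// ltr1n.
  apply: null_of_density_null => //; first exact: subset_trans UO.
  move=> G mG GC.
  have := @vector_variation_ge _ _ 1 _ oOmega (fun=> nu) U G (open_measurable_Rn oU) mG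
    (relcompact_sub GC cC) (subset_trans GC CsU).
  move=> /le_trans/(_ U0); rewrite lee_fin => e0.
  have := le_trans (ler_enorm (\row_(_ < 1) fine (nu G)) 0%R) e0.
  by rewrite mxE normr_le0 => /eqP.
apply: (@negligibleS _ _ _ _ (\bigcup_n E n)); last first.
  apply: negligible_bigcup => n; rewrite /E; case: (unpickle n) => [p|]; last first.
    exact: negligible_set0.
  case: ifPn => [/asboolP gp|_]; last exact: negligible_set0.
  apply/negligibleP; last exact: good_null.
  apply: emeasurable_neq => //; apply: measurable_funS mf => //.
  have [U [UO _ _ CU]] := gp; apply: subset_trans UO; apply: subset_trans CU.
  by apply: le_ball; rewrite ler_peMl ?ler1n// invr_ge0.
move=> x [[Ox nK] Zx]; have [U [oU [Ux [UO U0]]]] : exists U : set 'rV[R]_N,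
    open U /\ U x /\ U `<=` Omega /\ ~ 0 < signed_variation Omega nu U.
  apply: contrapT => nU; apply: nK; split=> // U oU Ux UO.
  by apply: contrapT => U0; apply: nU; exists U.
have [q [j [qx qU]]] := rational_ball_subset oU Ux.
exists (pickle (q, j)) => //; rewrite /E pickleK ifT//.
by apply/asboolP; exists U; split=> //; rewrite leNgt; apply/negP.
Qed.

(** Meant for [g] a partial derivative of a cutoff that is constant near the support: off the
    support [f] is 0 almost everywhere, on it [g] is 0. *)
Lemma signed_integral_support i g : measurable_fun Omega g ->
  (forall x, measure_support Omega nu x -> g x = 0) ->
  signed_integral Omega (A i) Omega (fun x => f x * g x) = 0.
Proof.
move=> mg g0; have [mp [mn [Hv _]]] := jordan_loc oOmega (rA i).
have int0 (m : {measure set T -> \bar R}) : (forall B, measurable B -> m B <= uv B) ->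
    \int[m]_(x in Omega) (f x * g x) = 0.
  move=> mu; rewrite -[RHS](integral0 m Omega); apply: ae_eq_integral => //.
    exact: emeasurable_funM.
  apply: negligibleS (support_complement_null mu) => x /= nx.
  have Ox : Omega x by apply: contrapT => nOx; apply: nx => /nOx.
  split; first by split=> // Kx; apply: nx => _; rewrite g0// mule0.
  by apply/negP => /eqP fx; apply: nx => _; rewrite fx mul0e.
have -> : signed_integral Omega (A i) Omega (fun x => f x * g x) =
    \int[mp]_(x in Omega) (f x * g x) - \int[mn]_(x in Omega) (f x * g x).
  by congr (_ - _); apply: eq_integral_set_function => B mB; case: (Hv B mB).
rewrite !int0 ?sube0// => B mB.
  by have [_ <-] := Hv B mB; exact: lower_variation_le_upper_vector.
by have [<- _] := Hv B mB; exact: upper_variation_le_upper_vector.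
Qed.

End support.

Section weighted_divergence.
Context {R : realType} {N : nat}.
Local Notation T := (Rn R N).
Variables (Omega : set T) (oOmega : open (Omega : set 'rV[R]_N)).
Variables (A : 'I_N -> set T -> \bar R) (rA : forall i, radon_loc Omega (A i)).
Variables (dA : set T -> \bar R) (divA : is_divergence Omega A dA).
Variable w : T -> \bar R.
Local Open Scope ereal_scope.
Hypothesis iwA : (vector_variation Omega A).-integrable Omega w.
Hypothesis iwd : (signed_variation Omega dA).-integrable Omega w.
Variable p : set T -> \bar R.
Hypothesis pP : represented_by Omega (fun phi =>
  - signed_integral Omega dA Omega (fun x => w x * (phi x)%:E) -
  \sum_(i < N) signed_integral Omega (A i) Omega
    (fun x => w x * (pderiv i phi x)%:E)) p.

Let mOmega : measurable Omega. Proof. exact: open_measurable_Rn. Qed.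

Let mu B := density_measure Omega w dA B + p B.

Let rdA : forall j : 'I_1, radon_loc Omega ((fun=> dA) j).
Proof. by move=> j; case: divA. Qed.

Let rw : radon_fin Omega (density_measure Omega w dA).
Proof. exact: (@density_radon_fin _ _ Omega oOmega 1 (fun=> dA) 0%R w rdA iwd). Qed.

Lemma weighted_divergence_radon_fin : radon_fin Omega mu.
Proof. by apply: radon_finD => //; case: pP. Qed.

Lemma weighted_field_signed_integral i phi : test_function Omega phi ->
  signed_integral Omega (weighted_field Omega w A i) Omega (EFin \o pderiv i phi) =
  signed_integral Omega (A i) Omega (fun x => w x * (pderiv i phi x)%:E).
Proof.
move=> tphi; have tp := test_function_pderiv i tphi.
have [C HC] := test_function_ebounded tp.
rewrite /weighted_field (density_signed_integral oOmega i (C := C) rA iwA)//.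
- exact: measurable_test_function tp.
- by move=> x _; exact: HC.
Qed.

Lemma weighted_divergence : is_divergence Omega (weighted_field Omega w A) mu.
Proof.
split; first exact: radon_fin_loc weighted_divergence_radon_fin.
move=> phi tphi; have [C HC] := test_function_ebounded tphi.
have mphi : measurable_fun Omega (EFin \o phi : T -> \bar R).
  exact: measurable_test_function tphi.
have bphi x : Omega x -> `|(EFin \o phi) x| <= C%:E by move=> _; exact: HC.
have [rp pE] := pP.
rewrite (signed_integralD oOmega rw rp mphi bphi) -pE//.
have dE := @density_signed_integral _ _ Omega oOmega 1 (fun=> dA) 0%R w
  (EFin \o phi) C rdA iwd mphi bphi.
have := signed_integral_fin_num oOmega rw mphi bphi.
(* The integral against [w div A] occurs once in [mu] and once with opposite sign in the pairing;
   being finite, it cancels. *)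
rewrite dE => dfin; rewrite addeA subee// add0e; congr (- _).
by apply: eq_bigr => i _; rewrite weighted_field_signed_integral.
Qed.

Section boundary.
Variables (G U0 U1 : set T) (mG : measurable G) (GO : G `<=` Omega).
Hypotheses (oU0 : open (U0 : set 'rV[R]_N)) (oU1 : open (U1 : set 'rV[R]_N)).
Hypotheses (U0O : U0 `<=` Omega) (U1O : U1 `<=` Omega).
Hypotheses (GU0 : G `&` U0 = set0) (U1G : U1 `<=` G).
Variable q : set T -> \bar R.
Hypothesis qP : represented_by Omega (fun phi =>
  - signed_integral Omega (divergence Omega (weighted_field Omega w A)) Omega
      (fun x => (\1_G x)%:E * (phi x)%:E) -
  \sum_(i < N) signed_integral Omega (A i) Omega
    (fun x => (\1_G x)%:E * w x * (pderiv i phi x)%:E)) q.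
Hypothesis supp : relcompact (measure_support Omega
  (density_measure Omega (fun x => (\1_G x)%:E * w x) (vector_variation Omega A))) Omega.

(** [divergence] is an arbitrary choice among the solutions of [is_divergence]. [mu] is another
    solution, and solutions agree on relatively compact Borel sets, which is all a signed integral
    sees. *)
Let div_sE f : signed_integral Omega (divergence Omega (weighted_field Omega w A)) Omega f =
  signed_integral Omega mu Omega f.
Proof.
apply: eq_signed_integral_relcompact.
have [rD HD] : is_divergence Omega (weighted_field Omega w A)
    (divergence Omega (weighted_field Omega w A)).
  by apply: xgetPex; exists mu; exact: weighted_divergence.
have [rmu Hmu] := weighted_divergence.
by apply: radon_unique => // phi tphi; rewrite HD// Hmu.
Qed.

(** For [c = 0] all integrands vanish; for [c = 1] the two terms cancel because [mu] is the
    divergence of the weighted field. Outside [V] the test function and its derivatives are 0. *)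
Lemma boundary_zero_of_constant (V : set T) (c : R) : open (V : set 'rV[R]_N) -> V `<=` Omega ->
  (forall x, V x -> \1_G x = c) -> c = 0%R \/ c = 1%R ->
  forall phi, test_function V phi -> signed_integral Omega q Omega (EFin \o phi) = 0.
Proof.
move=> oV VO Gc c01 phi tphi; have tphiO := test_functionS VO tphi.
have [rq qE] := qP; rewrite -qE// div_sE.
have E1 : (fun x => (\1_G x)%:E * (phi x)%:E) = (fun x => c%:E * (phi x)%:E).
  apply/funext => x; have [Vx|nVx] := pselect (V x); first by rewrite Gc.
  by rewrite (test_function_eq0 tphi nVx) !mule0.
have E2 i : (fun x => (\1_G x)%:E * w x * (pderiv i phi x)%:E) =
            (fun x => c%:E * (w x * (pderiv i phi x)%:E)).
  apply/funext => x; have [Vx|nVx] := pselect (V x); first by rewrite Gc// muleA.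
  by rewrite (test_function_eq0 (test_function_pderiv i tphi) nVx) !mule0.
rewrite E1; under eq_bigr do rewrite E2.
case: c01 => ->.
  have z (f : T -> \bar R) : (fun x => 0%R%:E * f x) = cst 0.
    by apply/funext => x; rewrite mul0e.
  rewrite z signed_integral0//; last by case: weighted_divergence.
  by rewrite big1 ?oppe0 ?adde0// => i _; rewrite z signed_integral0.
have z (f : T -> \bar R) : (fun x => 1%R%:E * f x) = f.
  by apply/funext => x; rewrite mul1e.
rewrite z; under eq_bigr do rewrite z.
have E : signed_integral Omega mu Omega (EFin \o phi) = - \sum_(i < N)
    signed_integral Omega (A i) Omega (fun x => w x * (pderiv i phi x)%:E).
  have [_ ->//] := weighted_divergence; congr (- _); apply: eq_bigr => i _.
  exact: weighted_field_signed_integral.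
have [C HC] := test_function_ebounded tphi.
have fin : signed_integral Omega mu Omega (EFin \o phi) \is a fin_num.
  apply: (@signed_integral_fin_num _ _ Omega oOmega mu _ C).
  - exact: weighted_divergence_radon_fin.
  - exact: measurable_test_function tphi.
  - by move=> x _; exact: HC.
by move: fin; rewrite E fin_numN => fin; rewrite oppeK subee.
Qed.

Lemma boundary_null (V : set T) (c : R) : open (V : set 'rV[R]_N) -> V `<=` Omega ->
  (forall x, V x -> \1_G x = c) -> c = 0%R \/ c = 1%R ->
  forall (q1 q2 : {measure set T -> \bar R}), difference_of Omega q q1 q2 ->
  forall B, measurable B -> B `<=` V -> q1 B = q2 B.
Proof.
move=> oV VO Gc c01 q1 q2 Hq; have mV := open_measurable_Rn oV.
have [fin1 fin2 _] := Hq.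
apply: measure_test_unique => //.
  move=> F mF cF; apply: (le_measure_Omega oOmega mF) => //.
  exact: subset_trans (relcompact_subset cF) VO.
move=> phi tphi _; have := boundary_zero_of_constant oV VO Gc c01 tphi.
have [C HC] := test_function_ebounded tphi.
have mphi : measurable_fun Omega (EFin \o phi : T -> \bar R).
  exact: measurable_test_function tphi.
have bphi x : Omega x -> `|(EFin \o phi) x| <= C%:E by move=> _; exact: HC.
rewrite (difference_signed_integral oOmega Hq mphi bphi).
have VE (m : {measure set T -> \bar R}) : \int[m]_(x in Omega) (EFin \o phi) x =
    \int[m]_(x in V) (phi x)%:E.
  rewrite integral_mkcond [RHS]integral_mkcond; congr (integral _ _ _).
  apply/funext => x; rewrite /patch; have [Vx|nVx] := pselect (V x).
    by rewrite !mem_set//; exact: VO.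
  by rewrite (memNset nVx) /= (test_function_eq0 tphi nVx); case: ifP.
have f1 := integrable_fin_num mOmega (bounded_integrable mOmega fin1 mphi bphi).
have f2 := integrable_fin_num mOmega (bounded_integrable mOmega fin2 mphi bphi).
move: f1 f2; rewrite !VE; move: (integral q1 _ _) (integral q2 _ _) => [a||] [b||]// _ _.
by move=> [/eqP]; rewrite subr_eq0 => /eqP ->.
Qed.

(** Written with sums of measures, the identity passes to the limit by monotone convergence in each
    of the four integrals separately. *)
Lemma boundary_total (q1 q2 m1 m2 : {measure set T -> \bar R}) :
  difference_of Omega q q1 q2 -> difference_of Omega mu m1 m2 ->
  q1 Omega + m1 G = q2 Omega + m2 G.
Proof.
move=> Hq Hm; have [W [phi [HW phi01 phi1 mW WO]]] := open_exhaustion oOmega.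
have tphi n : test_function Omega (phi n) by case: (HW n).
have phin x : Omega x -> \forall n \near \oo, phi n x = 1%R.
  by rewrite -WO; exact: exhaustion_near.
pose K := measure_support Omega (density_measure Omega
  (fun x => (\1_G x)%:E * w x) (vector_variation Omega A)).
have cK : relcompact K Omega := supp.
have [n0 KW] : exists n, closure K `<=` W n.
  apply: compact_sub_exhaustion => //; first by move=> n; case: (HW n).
    exact: relcompact_compact cK.
  by rewrite WO; case: cK.
have mphi n (D : set T) : measurable D -> measurable_fun D (EFin \o phi n : T -> \bar R).
  by move=> mD; exact: measurable_test_function (tphi n).
have bphi n x : `|(phi n x)%:E| <= 1.
  by have [/andP[h0 h1] _] := phi01 n x; rewrite lee_fin ger0_norm.
(* From [n0] on, the cutoff is 1 on the open set [W n0], which contains the closure of the support;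
   its derivatives vanish there, and [signed_integral_support] removes the gradient terms. *)
have qn n : (n0 <= n)%N -> signed_integral Omega q Omega (EFin \o phi n) =
    - signed_integral Omega mu Omega (fun x => (\1_G x)%:E * (phi n x)%:E).
  move=> n0n; have [_ <-//] := qP; rewrite div_sE big1 ?sube0// => i _.
  apply: (@signed_integral_support _ _ _ _ oOmega A rA w
    (fun x => (\1_G x)%:E * w x) iwA).
  - apply: emeasurable_funM; last by case/integrableP: iwA.
    by apply/measurable_EFinP; exact: measurable_funTS.
  - move=> x _; rewrite abseM; have [Gx|nGx] := pselect (G x).
      by rewrite indicE mem_set// abse1 mul1e.
    by rewrite indicE memNset// abse0 mul0e.
  - exact: measurable_test_function (test_function_pderiv i (tphi n)).
  - move=> x Kx; congr EFin; apply: (@pderiv_open_constant _ _ _ (W n0) 1%R).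
    + by case: (HW n0).
    + by move=> y; exact: phi1.
    + by apply: KW; exact: subset_closure.
have eqn n : (n0 <= n)%N -> \int[q1]_(x in Omega) (phi n x)%:E + \int[m1]_(x in G) (phi n x)%:E =
    \int[q2]_(x in Omega) (phi n x)%:E + \int[m2]_(x in G) (phi n x)%:E.
  move=> /qn; rewrite (difference_signed_integral oOmega Hq (mphi n _ mOmega) (fun x _ => bphi n x)).
  rewrite (@difference_signed_integral _ _ _ oOmega mu m1 m2 _ 1 Hm); last 2 first.
  - apply: emeasurable_funM; last exact: mphi.
    by apply/measurable_EFinP; exact: measurable_funTS.
  - move=> x _; rewrite abseM; have [Gx|nGx] := pselect (G x).
      by rewrite indicE mem_set// abse1 mul1e.
    by rewrite indicE memNset// abse0 mul0e.
  have GE (m : {measure set T -> \bar R}) :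
      \int[m]_(x in Omega) ((\1_G x)%:E * (phi n x)%:E) = \int[m]_(x in G) (phi n x)%:E.
    rewrite integral_mkcond [RHS]integral_mkcond; congr (integral _ _ _).
    apply/funext => x; rewrite /patch; have [Gx|nGx] := pselect (G x).
      by rewrite !mem_set ?indicE ?mem_set ?mul1e//; exact: GO.
    by rewrite (memNset nGx) indicE (memNset nGx) mul0e; case: ifP.
  rewrite !GE => E.
  have [q1f q2f _] := Hq; have [m1f m2f _] := Hm.
  have fin (m : {measure set T -> \bar R}) (D : set T) : m Omega < +oo -> measurable D ->
      D `<=` Omega -> \int[m]_(x in D) (phi n x)%:E \is a fin_num.
    move=> mf mD DO; apply: integrable_fin_num => //.
    apply: (@bounded_integrable _ _ _ m D _ 1) => //; last exact: mphi.
    by apply: le_measure_Omega mf.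
  move: E (fin q1 _ q1f mOmega (@subset_refl _ _)) (fin q2 _ q2f mOmega (@subset_refl _ _))
    (fin m1 _ m1f mG GO) (fin m2 _ m2f mG GO).
  move: (integral q1 _ _) (integral q2 _ _) (integral m1 _ _) (integral m2 _ _).
  by move=> [a||] [b||] [c||] [e||]// [E] _ _ _ _; congr EFin; lra.
have lim (m : {measure set T -> \bar R}) (D : set T) : measurable D -> D `<=` Omega ->
    \int[m]_(x in D) (phi n x)%:E @[n --> \oo] --> m D.
  move=> mD DO; rewrite -{2}(setIidl DO).
  exact: (@cvg_integral_test _ _ D Omega phi m mD tphi phi01 phin mOmega).
have [q1f q2f _] := Hq; have [m1f m2f _] := Hm.
have fm (m : {measure set T -> \bar R}) (D : set T) : m Omega < +oo -> measurable D ->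
    D `<=` Omega -> m D \is a fin_num.
  by move=> mf mD DO; rewrite ge0_fin_numE//; exact: le_measure_Omega mf.
pose s (m m' : {measure set T -> \bar R}) n :=
  \int[m]_(x in Omega) (phi n x)%:E + \int[m']_(x in G) (phi n x)%:E.
have cs (m m' : {measure set T -> \bar R}) : m Omega < +oo ->
    s m m' n @[n --> \oo] --> m Omega + m' G.
  move=> mf; apply: cvgeD; [|exact: lim|exact: lim].
  by apply: fin_num_adde_defr; exact: fm.
have cs' : s q1 m1 n @[n --> \oo] --> q2 Omega + m2 G.
  apply: cvg_trans (cs q2 m2 q2f); apply: near_eq_cvg.
  by exists n0 => // n /= n0n; rewrite /s eqn.
exact: (cvg_unique (@ereal_hausdorff R) (cs q1 m1 q1f) cs').
Qed.

(** [q1] and [q2] agree on [U0] and on [U1], so the total mass of [q] given by [boundary_total] is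
    the mass of the rest of [Omega]. *)
Lemma boundary_formula : mu G = - q (Omega `\` (U0 `|` U1)).
Proof.
have rq : radon_fin Omega q by case: qP.
have [q1 [q2 Hq]] := radon_fin_difference oOmega rq.
have [m1 [m2 Hm]] := radon_fin_difference oOmega weighted_divergence_radon_fin.
have tot := boundary_total Hq Hm.
have mU0 := open_measurable_Rn oU0; have mU1 := open_measurable_Rn oU1.
have z0 := @boundary_null U0 0%R oU0 U0O.
have {}z0 : forall B, measurable B -> B `<=` U0 -> q1 B = q2 B.
  apply: z0 => //; last by left.
  move=> x Ux; rewrite indicE memNset// => Gx.
  by have : (G `&` U0) x by []; rewrite GU0.
have z1 : forall B, measurable B -> B `<=` U1 -> q1 B = q2 B.
  apply: (@boundary_null U1 1%R) => //; last by right.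
  by move=> x Ux; rewrite indicE mem_set//; exact: U1G.
have mU : measurable (U0 `|` U1) by exact: measurableU.
have UO : U0 `|` U1 `<=` Omega by rewrite subUset.
have mB : measurable (Omega `\` (U0 `|` U1)) by exact: measurableD.
have qU : q1 (U0 `|` U1) = q2 (U0 `|` U1).
  have -> : U0 `|` U1 = U0 `|` (U1 `\` U0) by rewrite setUDr setDv setD0.
  have mD : measurable (U1 `\` U0) by exact: measurableD.
  have disj : U0 `&` (U1 `\` U0) = set0 by rewrite setDIK.
  rewrite (measureU q1)// (measureU q2)//; congr (_ + _); first exact: z0.
  by apply: z1 => //; exact: subDsetl.
have split (m : {measure set T -> \bar R}) :
    m Omega = m (Omega `\` (U0 `|` U1)) + m (U0 `|` U1).
  by rewrite -measureU ?setDKI// ?setDUK// setDKU.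
have [q1f q2f qE] := Hq; have [m1f m2f mE] := Hm.
have fm (m : {measure set T -> \bar R}) (D : set T) : m Omega < +oo -> measurable D ->
    D `<=` Omega -> m D \is a fin_num.
  by move=> mf mD DO; rewrite ge0_fin_numE//; exact: le_measure_Omega mf.
have BO : Omega `\` (U0 `|` U1) `<=` Omega by exact: subDsetl.
rewrite mE// qE//.
move: tot; rewrite (split q1) (split q2) qU.
move: (fm q1 _ q1f mB BO) (fm q2 _ q2f mB BO) (fm q2 _ q2f mU UO) (fm m1 _ m1f mG GO)
  (fm m2 _ m2f mG GO).
move: (q1 _) (q2 _) (q2 _) (m1 _) (m2 _).
by move=> [a||] [b||] [c||] [e||] [f||]// _ _ _ _ _ [E]; congr EFin; lra.
Qed.

End boundary.
End weighted_divergence.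

(** * The Gauss-Green formulas *)

Section gauss_green.
Context {R : realType} {N : nat}.
Local Notation T := (Rn R N).
Variables (Omega : set T) (oOmega : open (Omega : set 'rV[R]_N)).
Variables (A : 'I_N -> set T -> \bar R) (A_DM : DM_loc Omega A).
Variables (lam u : T -> R) (u_BV : BV_space Omega A lam u).
Variables (E : set T) (mE : measurable E) (EO : E `<=` Omega).
Local Open Scope ereal_scope.

Local Notation ulam := (lam_rep Omega lam u).

Lemma lam_rep_indic (t : R) (G : set T) : (t = 0 /\ G = density1 E \/
    t = 1 /\ G = density1 E `|` ess_boundary E)%R ->
  forall x, Omega x -> lam_rep Omega (fun=> t) (\1_E : T -> R) x = (\1_G x)%:E.
Proof.
move=> tG x Ox; rewrite /lam_rep lower_rep_indic// upper_rep_indic//.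
by case: tG => -[-> ->]; rewrite ?(subr0, subrr) mul0e mul1e ?add0e ?adde0.
Qed.

(** The pair [t], [G] treats both representatives at once. The open sets [U0] and [U1] of
    [boundary_formula] become the points of [Omega] near which [E], respectively its complement, is
    Lebesgue-null. *)
Lemma gauss_green_weighted (t : R) (G : set T) : (t = 0 /\ G = density1 E \/
    t = 1 /\ G = density1 E `|` ess_boundary E)%R ->
  weighted_BV_space Omega ulam A t (\1_E : T -> R) ->
  relcompact (measure_support Omega (density_measure Omega
    (fun x => (\1_G x)%:E * ulam x) (vector_variation Omega A))) Omega ->
  signed_integral Omega (divergence Omega A) (G `&` Omega) ulam
    + pairing_measure Omega A lam u (G `&` Omega)
  = - weighted_pairing_measure Omega ulam A t (\1_E : T -> R) (minus_boundary E `&` Omega).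
Proof.
move=> tG [[_ /integrableP[mchi _] _] exq] supp.
have repE := lam_rep_indic tG.
have [[_ iwA iwd] exp] := u_BV.
have [rA exd] := A_DM.
have divA : is_divergence Omega A (divergence Omega A) by exact: xgetPex.
have pP : represented_by Omega (pairing Omega A lam u) (pairing_measure Omega A lam u).
  exact: xgetPex.
have qP : represented_by Omega (weighted_pairing Omega ulam A t (\1_E : T -> R))
    (weighted_pairing_measure Omega ulam A t (\1_E : T -> R)).
  exact: xgetPex.
have mO : measurable Omega := open_measurable_Rn oOmega.
(* In [Omega] the set [G] is the level set at 1 of the representative of the indicator, which is
   measurable because it is integrable by hypothesis. *)
have mG : measurable (G `&` Omega).
  suff -> : G `&` Omega =
      Omega `&` lam_rep Omega (fun=> t) (\1_E : T -> R) @^-1` [set 1].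
    by apply: mchi => //; exact: emeasurable_set1.
  apply/seteqP; split=> x [].
    by move=> Gx Ox; split=> //=; rewrite repE// indicE mem_set.
  move=> Ox /=; rewrite repE// indicE; have [//|nG] := pselect (G x).
  by rewrite memNset// => /eqP; rewrite eq_sym onee_eq0.
have indE x : Omega x -> \1_(G `&` Omega) x = \1_G x :> R.
  move=> Ox; rewrite !indicE; congr (_ _)%:R; apply/idP/idP; rewrite !inE.
    by case.
  by split.
have nE0 x : null_near E x -> ~ G x.
  move=> nE; have := null_near_closure mE nE.
  by case: tG => -[_ ->] // h Ex; apply: h; left.
have nE1 x : null_near (~` E) x -> G x.
  move=> /(null_nearC_density1 mE) dE.
  by case: tG => -[_ ->] //; left.
have mCE : measurable (~` E) by exact: measurableC.
have -> : minus_boundary E `&` Omega =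
    Omega `\` ((null_near E `&` Omega) `|` (null_near (~` E) `&` Omega)).
  by rewrite -setIUl -setC_minus_boundary// setDIr setDv setU0 setDE setCK setIC.
pose q := weighted_pairing_measure Omega ulam A t (\1_E : T -> R).
have GO : G `&` Omega `<=` Omega by exact: subIsetr.
have oU0 : open (null_near E `&` Omega : set 'rV[R]_N).
  by apply: openI => //; exact: open_null_near.
have oU1 : open (null_near (~` E) `&` Omega : set 'rV[R]_N).
  by apply: openI => //; exact: open_null_near.
have GU0 : G `&` Omega `&` (null_near E `&` Omega) = set0.
  by apply/seteqP; split=> // x [[Gx _] [nE _]]; exact: (nE0 x).
have U1G : null_near (~` E) `&` Omega `<=` G `&` Omega by move=> x [/nE1 Gx Ox].
have qP' : represented_by Omega (fun phi =>
    - signed_integral Omega (divergence Omega (weighted_field Omega ulam A)) Omega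
        (fun x => (\1_(G `&` Omega) x)%:E * (phi x)%:E) -
    \sum_(i < N) signed_integral Omega (A i) Omega
      (fun x => (\1_(G `&` Omega) x)%:E * ulam x * (pderiv i phi x)%:E)) q.
  have [rq qE] := qP; split=> // phi tphi; rewrite -qE// /weighted_pairing.
  congr (- _ - _).
    by apply: eq_signed_integral => x /[!inE] Ox; rewrite repE// indE.
  apply: eq_bigr => i _; apply: eq_signed_integral => x /[!inE] Ox.
  by rewrite repE// indE.
have supp' : relcompact (measure_support Omega (density_measure Omega
    (fun x => (\1_(G `&` Omega) x)%:E * ulam x) (vector_variation Omega A))) Omega.
  rewrite (_ : density_measure _ _ _ = density_measure Omega
    (fun x => (\1_G x)%:E * ulam x) (vector_variation Omega A))//.
  apply/funext => B; apply: eq_signed_integral => x /[!inE] -[_ Ox].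
  by rewrite indE.
have := boundary_formula oOmega rA divA iwA iwd pP mG GO oU0 oU1
  (@subIsetr _ _ _) (@subIsetr _ _ _) GU0 U1G qP' supp'.
by rewrite /density_measure -setIA setIid.
Qed.

End gauss_green.

Theorem theorem1p1 (R : realType) (N : nat) (N_gt0 : (0 < N)%N)
    (Omega : set 'rV[R]_N) (Omega_open : open Omega)
    (Omega_neq0 : Omega !=set0)
    (A : 'I_N -> set (Rn R N) -> \bar R) (A_DM : DM_loc Omega A)
    (lam : Rn R N -> R) (lam_borel : measurable_fun (Omega : set (Rn R N)) lam)
    (lam01 : forall x, Omega x -> 0 <= lam x <= 1)
    (u : Rn R N -> R) (u_BV : BV_space Omega A lam u)
    (E : set (Rn R N)) (E_borel : measurable E) (E_sub : E `<=` Omega) :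
  let ulam := lam_rep Omega lam u in
  let chiE := \1_E : Rn R N -> R in
  let E1 := density1 E `&` Omega in
  let E1b := (density1 E `|` ess_boundary E) `&` Omega in
  let bE := minus_boundary E `&` Omega in
  (weighted_BV_space Omega ulam A 0 chiE ->
   relcompact
     (measure_support Omega (density_measure Omega
        (fun x => lower_rep Omega chiE x * ulam x)%E (vector_variation Omega A)))
     Omega ->
   (signed_integral Omega (divergence Omega A) E1 ulam
      + pairing_measure Omega A lam u E1
    = - weighted_pairing_measure Omega ulam A 0 chiE bE)%E)
  /\
  (weighted_BV_space Omega ulam A 1 chiE ->
   relcompact
     (measure_support Omega (density_measure Omega
        (fun x => upper_rep Omega chiE x * ulam x)%E (vector_variation Omega A)))
     Omega ->
   (signed_integral Omega (divergence Omega A) E1b ulam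
      + pairing_measure Omega A lam u E1b
    = - weighted_pairing_measure Omega ulam A 1 chiE bE)%E).
Proof.
move=> ulam chiE E1 E1b bE; split=> BV supp.
  apply: (gauss_green_weighted Omega_open A_DM u_BV E_borel E_sub
    (or_introl (conj erefl erefl)) BV).
  rewrite (_ : density_measure _ _ _ = density_measure Omega
    (fun x => lower_rep Omega chiE x * ulam x)%E (vector_variation Omega A))//.
  apply/funext => B; apply: eq_signed_integral => x /[!inE] -[_ Ox].
  by rewrite /chiE lower_rep_indic.
apply: (gauss_green_weighted Omega_open A_DM u_BV E_borel E_sub
  (or_intror (conj erefl erefl)) BV).
rewrite (_ : density_measure _ _ _ = density_measure Omega
  (fun x => upper_rep Omega chiE x * ulam x)%E (vector_variation Omega A))//.
apply/funext => B; apply: eq_signed_integral => x /[!inE] -[_ Ox].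
by rewrite /chiE upper_rep_indic.
Qed.
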